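(* Let $(M^7,\varphi)$ be a $G_2$ manifold, with its induced metric, orientation, cross product $\times$ and tangent-bundle-valued $3$-form $\chi$. Let $\Lambda=\langle u,v\rangle$ be an orthonormal $2$-frame field on $M$, let $\mathbf{E}=\langle u,v,u\times v\rangle$ and $\mathbf{V}=\mathbf{E}^{\perp}$, and let $w$ be a unit section of $\mathbf{V}$ over $U$, where $U\subset M$ is an open tubular neighborhood of the $3$-skeleton of $M$ (or $U=M$ if $w$ exists globally), so that $u,v,w$ are orthonormal on $U$ and $\varphi(u,v,w)=0$. On $U$ put $$R=\chi(u,v,w)=-u\times(v\times w),\qquad R'=\tfrac{1}{\sqrt3}(u\times v+v\times w+w\times u),\qquad R''=\tfrac{1}{\sqrt3}(u+v+w).$$ For a unit vector field $\xi$ with $\xi^\perp$ integrable, let $X_\xi$ be a leaf of $\xi^\perp$ and let $J_\xi$ be the almost complex structure on $X_\xi$ given by $J_\xi(x)=x\times\xi$. Then the following hold, where each formula involving $a,b,c$ is asserted for all real numbers $a,b,c$ with $a+b+c=0$, and each span is taken over all such $(a,b,c)$. (a) If the $6$-plane field $R^\perp$ is integrable and $X_R$ is a leaf of it, then along $X_R$ $$TX_R=\operatorname{span}\{\,au+bv+cw,\ R'',\ R',\ a(v\times w)+b(w\times u)+c(u\times v)\ :\ a+b+c=0\,\},$$ $$J_R(au+bv+cw)=-a(v\times w)-b(w\times u)-c(u\times v),\qquad J_R(R'')=-R'.$$ (b) If the $6$-plane field $R'^\perp$ is integrable and $X_{R'}$ is a leaf of it, then along $X_{R'}$ $$TX_{R'}=\operatorname{span}\{\,au+bv+cw,\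 R'',\ R,\ a(v\times w)+b(w\times u)+c(u\times v)\ :\ a+b+c=0\,\},$$ $$J_{R'}(au+bv+cw)=-\tfrac{1}{\sqrt3}\big((b-c)u+(c-a)v+(a-b)w\big),$$ $$J_{R'}\big(a(v\times w)+b(w\times u)+c(u\times v)\big)=\tfrac{1}{\sqrt3}\big((b-c)(v\times w)+(c-a)(w\times u)+(a-b)(u\times v)\big),$$ $$J_{R'}(R'')=R.$$ (c) If the $6$-plane field $R''^\perp$ is integrable and $X_{R''}$ is a leaf of it, then along $X_{R''}$ $$TX_{R''}=\operatorname{span}\{\,au+bv+cw,\ R,\ R',\ a(v\times w)+b(w\times u)+c(u\times v)\ :\ a+b+c=0\,\},$$ $$J_{R''}(au+bv+cw)=\tfrac{1}{\sqrt3}\big((b-a)(u\times v)+(c-b)(v\times w)+(a-c)(w\times u)\big),\qquad J_{R''}(R)=R'.$$ (d) $\{u,v,w,R,u\times v,v\times w,w\times u\}$ is an orthonormal frame field on $U$.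
   Context: On $\mathbb{R}^7$ with standard metric and orientation $e^{1234567}$ let $\varphi_0=e^{123}+e^{145}+e^{167}+e^{246}-e^{257}-e^{347}-e^{356}$, where $e^{ijk}=dx^i\wedge dx^j\wedge dx^k$. A $7$-manifold $M$ has a $G_2$ structure if it carries a $3$-form $\varphi$ such that at each $p\in M$ the pair $(T_pM,\varphi(p))$ is linearly isomorphic to $(\mathbb{R}^7,\varphi_0)$; the metric $\langle\cdot,\cdot\rangle$, the orientation and the Hodge star $*$ on $M$ are those transported from $\mathbb{R}^7$ by such isomorphisms. $(M,\varphi)$ is a $G_2$ manifold if around each point there is a chart in which $\varphi=\varphi_0+O(|x|^2)$. The cross product is defined by $\langle x\times y,z\rangle=\varphi(x,y,z)$, and the tangent-bundle-valued $3$-form $\chi$ is defined by $\langle\chi(x,y,z),t\rangle=*\varphi(x,y,z,t)$. For a unit vector field $\xi$ such that the $6$-plane field $\xi^\perp$ is integrable, $X_\xi$ denotes a leaf of $\xi^\perp$, and $J_\xi$ is the almost complex structure on $X_\xi$ given by $J_\xi(x)=x\times\xi$ for $x\in\xi^\perp$.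
   Formalization: The formal theorem uses J_ξ(x)=ξ×x instead of x×ξ: with x×ξ all displayed J formulas fail by a sign (flat R^7, u=e1, v=e2, w=e4 gives R''×R=+R', not −R'). *)

(* Defs.v *)
From HB Require Import structures.
From mathcomp Require Import all_boot all_order all_algebra.
From mathcomp Require Import all_classical all_reals all_analysis.

Set Implicit Arguments.
Unset Strict Implicit.
Unset Printing Implicit Defensive.

Import Order.TTheory GRing.Theory Num.Theory.
Import numFieldNormedType.Exports.

Local Open Scope classical_set_scope.
Local Open Scope ring_scope.

Definition lspan (R : realType) (V : lmodType R) (A : set V) : set V :=
  [set x | exists n (a : 'I_n -> R) (g : 'I_n -> V),
     (forall i, A (g i)) /\ x = \sum_i a i *: g i].

Definition comb0 (R : realType) (V : lmodType R) (x y z : V) : set V :=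
  [set t | exists a b c : R, a + b + c = 0 /\ t = a *: x + b *: y + c *: z].

Fixpoint Ck (R : realType) (V W : normedModType R) (k : nat) (A : set V)
    (f : V -> W) : Prop :=
  match k with
  | 0%N => forall x, A x -> {for x, continuous f}
  | k'.+1 => (forall x, A x -> differentiable f x) /\
             (forall v : V, Ck k' A (fun x => 'D_v f x))
  end.

(* To be used on open sets [A] only. *)
Definition smooth_on (R : realType) (V W : normedModType R) (A : set V)
    (f : V -> W) : Prop := forall k, Ck k A f.

(* The values of [chart_map] outside [chart_dom], and of [chart_inv] outside
   the image of [chart_dom], carry no meaning. *)
Record chart (R : realType) (n : nat) (M : topologicalType) := Chart {
  chart_dom : set M;
  chart_map :> M -> 'rV[R]_n;
  chart_inv : 'rV[R]_n -> M;
  chart_dom_open : open chart_dom;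
  chart_img_open : open (chart_map @` chart_dom);
  chart_mapK : {in chart_dom, cancel chart_map chart_inv};
  chart_map_cont : {in chart_dom, continuous chart_map};
  chart_inv_cont : {in chart_map @` chart_dom, continuous chart_inv} }.

Definition chart_img (R : realType) n (M : topologicalType) (c : chart R n M) :
  set 'rV[R]_n := c @` chart_dom c.

Definition chart_compatible (R : realType) n (M : topologicalType)
    (c d : chart R n M) : Prop :=
  smooth_on (c @` (chart_dom c `&` chart_dom d)) (d \o chart_inv c) /\
  smooth_on (d @` (chart_dom c `&` chart_dom d)) (c \o chart_inv d).

Record smooth_manifold (R : realType) (n : nat) := SmoothManifold {
  man_space :> topologicalType;
  man_hausdorff : hausdorff_space man_space;
  man_second_countable : @second_countable man_space;
  atlas : set (chart R n man_space);
  atlas_cover : forall p, exists2 c, atlas c & chart_dom c p;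
  atlas_compatible : forall c d, atlas c -> atlas d -> chart_compatible c d;
  atlas_maximal : forall c,
    (forall d, atlas d -> chart_compatible c d) -> atlas c }.

Definition chart_around (R : realType) n (M : smooth_manifold R n) (p : M)
  (c : chart R n M) : Prop := atlas c /\ chart_dom c p.

Definition chart_at (R : realType) n (M : smooth_manifold R n) (p : M) :
    chart R n M := projT1 (cid2 (atlas_cover p)).

(* A tangent vector at [p] is a family of coordinate vectors,
    one for each chart around [p] (and 0 for the other charts), which transforms
    under the derivatives of the transition maps. *)
Definition tangent_family (R : realType) n (M : smooth_manifold R n) (p : M) :
    {pred (chart R n M -> 'rV[R]_n)} :=
  fun a => `[< (forall c, ~ chart_around p c -> a c = 0) /\
    (forall c d, chart_around p c -> chart_around p d ->
       a d = 'd (d \o chart_inv c) (c p) (a c)) >].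

Section TangentSpace.
Variables (R : realType) (n : nat) (M : smooth_manifold R n) (p : M).

Fact tangent_family_submod : submod_closed (@tangent_family R n M p).
Proof.
split=> [|k a b /asboolP[a0 aE] /asboolP[b0 bE]]; apply/asboolP; split.
- by [].
- by move=> c d _ _; rewrite linear0.
- move=> c pc; rewrite (_ : _ c = k *: a c + b c)//.
  by rewrite a0// b0// scaler0 addr0.
- move=> c d pc pd; rewrite (_ : _ d = k *: a d + b d)//.
  by rewrite (aE c d)// (bE c d)// -linearP.
Qed.

HB.instance Definition _ := GRing.isSubmodClosed.Build R
  (chart R n M -> 'rV[R]_n)
  (@tangent_family R n M p) tangent_family_submod.

Record tangent := Tangent {
  tangent_val :> chart R n M -> 'rV[R]_n;
  _ : tangent_val \in @tangent_family R n M p }.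

HB.instance Definition _ := [isSub for tangent_val].
HB.instance Definition _ := [Choice of tangent by <:].
HB.instance Definition _ := [SubChoice_isSubLmodule of tangent by <:].

End TangentSpace.


Definition tcoord (R : realType) n (M : smooth_manifold R n) (c : chart R n M)
  (p : M) (x : tangent p) : 'rV[R]_n := tangent_val x c.

Section TangentOf.
Variables (R : realType) (n : nat) (M : smooth_manifold R n).

(* The tangent vector at [p] with coordinates [a] in the chart [c]; it is 0 if
   [c] is not a chart around [p]. *)
Definition tangent_of (c : chart R n M) (p : M) (a : 'rV[R]_n) : tangent p :=
  insubd (0 : tangent p)
    (fun d => if `[< chart_around p d >]
              then 'd (d \o chart_inv c) (c p) a else 0).

Let near_inv (c : chart R n M) p (D : set M) : open D -> chart_dom c p -> D p ->
  \forall x \near c p, chart_img c x /\ D (chart_inv c x).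
Proof.
move=> oD cp Dp; have cpi : chart_img c (c p) by exists p.
apply: filterI.
  by apply: open_nbhs_nbhs; split=> //; exact: chart_img_open.
apply: (chart_inv_cont (c := c)); first exact: mem_set.
by rewrite chart_mapK ?inE//; exact: open_nbhs_nbhs.
Qed.

Let trans_diff (c d : chart R n M) p : chart_around p c -> chart_around p d ->
  differentiable (d \o chart_inv c) (c p).
Proof.
move=> [Ac cp] [Ad dp]; have [/(_ 1%N)[+ _] _] := atlas_compatible Ac Ad.
by apply; exists p.
Qed.

Let trans_comp (c e d : chart R n M) p a :
  chart_around p c -> chart_around p e -> chart_around p d ->
  'd (d \o chart_inv c) (c p) a =
  'd (d \o chart_inv e) (e p) ('d (e \o chart_inv c) (c p) a).
Proof.
move=> pc pe pd; have [[_ cp] [_ ep]] := (pc, pe).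
have Hp : (e \o chart_inv c) (c p) = e p by rewrite /= chart_mapK ?inE.
have De := trans_diff pc pe; have Dd := trans_diff pe pd.
rewrite -Hp in Dd *.
refine (eq_trans _ (congr1 (fun f => f a) (diff_comp De Dd))).
refine (eq_trans (esym (deriveE a (trans_diff pc pd))) _).
refine (eq_trans _ (deriveE a (differentiable_comp De Dd))).
apply: near_eq_derive.
have := near_inv (chart_dom_open e) cp ep; apply: filterS => x [_ ex].
by rewrite /= chart_mapK ?inE.
Qed.

Let trans_id (c : chart R n M) p a : chart_around p c ->
  'd (c \o chart_inv c) (c p) a = a.
Proof.
move=> pc; rewrite -(deriveE a (trans_diff pc pc)).
rewrite (@near_eq_derive _ _ _ _ id) ?derive_id//.
have := near_inv openT pc.2 Logic.I; apply: filterS => x [[q cq <-] _].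
by rewrite /= chart_mapK ?inE.
Qed.

Lemma tangent_of_coord (c : chart R n M) p a :
  chart_around p c -> tcoord c (tangent_of c p a) = a.
Proof.
move=> pc; rewrite /tcoord /tangent_of val_insubd ifT.
  by rewrite asboolT// trans_id.
apply/asboolP; split=> [d pd|d e pd pe]; first by rewrite asboolF.
rewrite (asboolT pd) (asboolT pe); exact: trans_comp.
Qed.

End TangentOf.

Definition smooth_map (R : realType) m n (X : smooth_manifold R m)
    (M : smooth_manifold R n) (f : X -> M) : Prop :=
  continuous f /\
  forall c d, atlas c -> atlas d ->
    smooth_on (c @` (chart_dom c `&` f @^-1` chart_dom d))
      (d \o f \o chart_inv c).

(* For a smooth [f] this does not depend on the two charts. *)
Definition tangent_map (R : realType) m n (X : smooth_manifold R m)
    (M : smooth_manifold R n) (f : X -> M) (x : X) (v : tangent x) :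
    tangent (f x) :=
  let c := chart_at x in let d := chart_at (f x) in
  tangent_of d (f x) ('d (d \o f \o chart_inv c) (c x) (tcoord c v)).
Arguments tangent_map {R m n X M} f x v.

Definition vector_field (R : realType) n (M : smooth_manifold R n) :=
  forall p : M, tangent p.

Definition smooth_field (R : realType) n (M : smooth_manifold R n) (U : set M)
    (xi : vector_field M) : Prop :=
  forall c, atlas c ->
    smooth_on (c @` (chart_dom c `&` U))
      (fun x => tcoord c (xi (chart_inv c x))).

(* The coordinates of R^7 are numbered from 1 to 7. *)
Definition dx (R : realType) (i : nat) (x : 'rV[R]_7) : R := x 0 (inord i.-1).

(* dx^i /\ dx^j /\ dx^k, without a factor 1/3!. *)
Definition wedge3 (R : realType) (i j k : nat) (x y z : 'rV[R]_7) : R :=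
  \det (\matrix_(r < 3, s < 3)
    dx (nth 0%N [:: i; j; k] s) (nth 0 [:: x; y; z] r)).

Definition phi0 (R : realType) (x y z : 'rV[R]_7) : R :=
  wedge3 1 2 3 x y z + wedge3 1 4 5 x y z + wedge3 1 6 7 x y z
  + wedge3 2 4 6 x y z - wedge3 2 5 7 x y z - wedge3 3 4 7 x y z
  - wedge3 3 5 6 x y z.

Definition dot7 (R : realType) (x y : 'rV[R]_7) : R := \sum_i x 0 i * y 0 i.

(* The Hodge star of a 3-form on R^7 with the standard metric and orientation:
   the sum of alpha(e_i,e_j,e_k) *e^{ijk} over i < j < k, where *e^{ijk} is the
   4-form det(e_i, e_j, e_k, -, -, -, -). *)
Definition hodge3 (R : realType) (alpha : 'rV[R]_7 -> 'rV[R]_7 -> 'rV[R]_7 -> R)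
    (x y z t : 'rV[R]_7) : R :=
  let e (i : 'I_7) : 'rV[R]_7 := delta_mx 0 i in
  \sum_(i < 7) \sum_(j < 7 | (i < j)%N) \sum_(k < 7 | (j < k)%N)
    alpha (e i) (e j) (e k) *
    \det (\matrix_(r < 7) nth 0 [:: e i; e j; e k; x; y; z; t] r).

Definition field3 (R : realType) n (M : smooth_manifold R n) :=
  forall p : M, tangent p -> tangent p -> tangent p -> R.

Definition coef3 (R : realType) n (M : smooth_manifold R n) (phi : field3 M)
    (c : chart R n M) (a b d : 'rV[R]_n) (x : 'rV[R]_n) : R^o :=
  let p := chart_inv c x in
  phi p (tangent_of c p a) (tangent_of c p b) (tangent_of c p d).

Record G2_frame (R : realType) (M : smooth_manifold R 7) (phi : field3 M)
    (p : M) := G2Frame {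
  frame_coord :> {linear tangent p -> 'rV[R]_7};
  frame_vec : 'rV[R]_7 -> tangent p;
  frame_coordK : cancel frame_coord frame_vec;
  frame_vecK : cancel frame_vec frame_coord;
  frame_phi : forall x y z,
    phi p x y z = phi0 (frame_coord x) (frame_coord y) (frame_coord z) }.

(* [G2_model] implies that [G2_form] is multilinear and alternating. *)
Record G2_structure (R : realType) (M : smooth_manifold R 7) := G2Structure {
  G2_form :> field3 M;
  G2_smooth : forall c, atlas c -> forall a b d : 'rV[R]_7,
    smooth_on (chart_img c) (coef3 G2_form c a b d);
  G2_model : forall p, $| G2_frame G2_form p | }.

Definition is_G2_manifold (R : realType) (M : smooth_manifold R 7)
    (phi : G2_structure M) : Prop :=
  forall p : M, exists2 c, chart_around p c & c p = 0 /\
    forall a b d : 'rV[R]_7,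
      (fun x => coef3 phi c a b d x - phi0 a b d : R^o)
        =O_ (0 : 'rV[R]_7) (fun x => `|x| ^+ 2 : R^o).

Section G2Geometry.
Variables (R : realType) (M : smooth_manifold R 7) (phi : G2_structure M).

(* The metric and the Hodge star transported by [G2_frame_at p] do not depend on
   the choice made here, as the linear automorphisms of phi0 belong to SO(7). *)
Definition G2_frame_at (p : M) : G2_frame phi p := unsquash (G2_model phi p).

Definition metric (p : M) (x y : tangent p) : R :=
  dot7 (G2_frame_at p x) (G2_frame_at p y).

Definition star_phi (p : M) (x y z t : tangent p) : R :=
  let A := G2_frame_at p in
  hodge3 (fun a b c =>
      G2_form phi (frame_vec A a) (frame_vec A b) (frame_vec A c))
    (A x) (A y) (A z) (A t).

Definition cross (p : M) (x y : tangent p) : tangent p :=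
  xget 0 [set v | forall z, metric v z = G2_form phi x y z].

Definition chi (p : M) (x y z : tangent p) : tangent p :=
  xget 0 [set v | forall t, metric v t = star_phi x y z t].

Definition perp (p : M) (A : set (tangent p)) : set (tangent p) :=
  [set x | forall y, A y -> metric x y = 0].

Definition orthonormal_frame (U : set M) (s : seq (vector_field M)) : Prop :=
  let f i : vector_field M := nth (fun p => 0) s i in
  (forall i, (i < size s)%N -> smooth_field U (f i)) /\
  (forall p, U p -> forall i j, (i < size s)%N -> (j < size s)%N ->
     metric (f i p) (f j p) = (i == j)%:R).

Definition plane_field (xi : vector_field M) (p : M) : set (tangent p) :=
  perp [set xi p].
Arguments plane_field xi p : clear implicits.

Record integral_manifold (U : set M) (xi : vector_field M)
    (X : smooth_manifold R 6) (iota : X -> M) : Prop := IntegralManifold {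
  int_smooth : smooth_map iota;
  int_inj : injective iota;
  int_sub : range iota `<=` U;
  int_connected : connected [set: X];
  int_immersion : forall x : X, injective (tangent_map iota x);
  int_tangent : forall x : X,
    range (tangent_map iota x) = plane_field xi (iota x) }.

Definition plane_integrable (U : set M) (xi : vector_field M) : Prop :=
  forall p, U p -> exists (X : smooth_manifold R 6) (iota : X -> M),
    integral_manifold U xi iota /\ range iota p.

Definition is_leaf (U : set M) (xi : vector_field M) (X : smooth_manifold R 6)
    (iota : X -> M) : Prop :=
  [/\ [set: X] !=set0, integral_manifold U xi iota &
    forall (Y : smooth_manifold R 6) (kappa : Y -> M),
      integral_manifold U xi kappa -> range iota `<=` range kappa ->
      range kappa = range iota].

(* J_xi(x) = xi \times x. With the opposite sign x \times xi, every identity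
   for J_R, J_R' and J_R'' in the theorem would change sign. *)
Definition Jxi (xi : vector_field M) (p : M) (x : tangent p) : tangent p :=
  cross (xi p) x.

End G2Geometry.

Definition cube (R : realType) (n : nat) : set 'rV[R]_n :=
  [set x | forall i, `|x 0 i| <= 1].

Definition open_cube (R : realType) (n : nat) : set 'rV[R]_n :=
  [set x | forall i, `|x 0 i| < 1].

(* Cells are parametrised by cubes, which are homeomorphic to balls. The ambient
   space is assumed to be Hausdorff. *)
Record CW_structure (R : realType) (M : topologicalType) := CWStructure {
  cell : Type;
  cell_dim : cell -> nat;
  cell_map : forall i, 'rV[R]_(cell_dim i) -> M;
  cell_cont : forall i, {within @cube R (cell_dim i), continuous (@cell_map i)};
  cell_inj : forall i, set_inj (@open_cube R (cell_dim i)) (@cell_map i);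
  cell_partition : forall p, exists! i,
    (@cell_map i @` @open_cube R (cell_dim i)) p;
  cell_boundary : forall i, exists2 F : set cell,
    finite_set F /\ (forall j, F j -> (cell_dim j < cell_dim i)%N) &
    @cell_map i @` (@cube R (cell_dim i) `\` @open_cube R (cell_dim i)) `<=`
      \bigcup_(j in F) (@cell_map j @` @open_cube R (cell_dim j));
  cell_weak : forall A : set M,
    (forall i, closed (@cube R (cell_dim i) `&` @cell_map i @^-1` A)) ->
    closed A }.

Definition skeleton (R : realType) (M : topologicalType)
    (K : CW_structure R M) (k : nat) : set M :=
  [set p | exists2 i, (cell_dim i <= k)%N &
     (@cell_map _ _ K i @` @open_cube R (cell_dim i)) p].

(* A skeleton need not be a submanifold: a tubular neighbourhood of it is an open
   set which retracts onto it by a strong deformation. *)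
Definition tubular_neighborhood (R : realType) (M : topologicalType)
    (U S : set M) : Prop :=
  [/\ open U, S `<=` U & exists H : M * R -> M,
    [/\ {within U `*` `[0, 1], continuous H},
      forall p t, U p -> 0 <= t <= 1 -> U (H (p, t)),
      forall p, U p -> H (p, 0) = p,
      forall p, U p -> S (H (p, 1)) &
      forall p t, S p -> 0 <= t <= 1 -> H (p, t) = p]].

(* Main.v *)
(* Everything except smoothness is algebra in a tangent space.  By the identity
     x * (y * z) + y * (x * z) = - 2 <x,y> z + <x,z> y + <y,z> x
   and chi(x,y,z) = - x * (y * z) - <x,y> z + <x,z> y, both polynomial identities
   in R^7, the multiplication table and the Gram matrix of
   u, v, w, R, u * v, v * w, w * u follow from those of the triple (u, v, w), and
   then the tangent spaces and the three operators J are read off.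

   The metric is only defined pointwise from phi, so the smoothness of cross
   products has to be derived from that of phi.  First, R is the unique solution
   of the linear equations u * R = v * w and v * R = w * u, written with phi
   alone.  Next, choose smooth fields t1, t2, t3 dual to the 1-forms phi(u,v,-),
   phi(v,w,-), phi(w,u,-); they agree with u * v, v * w, w * u up to
   combinations of u, v, w, R, and these combinations can be computed from the
   values phi(x,ti,tj) with x among u, v, w, R. *)

Require Import Defs.
From mathcomp Require Import all_boot all_order all_algebra.
From mathcomp Require Import all_classical all_reals all_analysis.
From mathcomp Require Import zify ring lra.

Set Implicit Arguments.
Unset Strict Implicit.
Unset Printing Implicit Defensive.

Import Order.TTheory GRing.Theory Num.Theory.
Import numFieldNormedType.Exports.

Local Open Scope classical_set_scope.
Local Open Scope ring_scope.

(** * Smooth functions *)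

Section SmoothFunctions.
Variables (R : realType) (V : normedModType R).

(** The zero linear map has zero remainder here, so by uniqueness it is the differential.
    Differentiability of [g] then follows from that of a nearby equal [f] by writing
    [g = f + (g - f)]. *)
Lemma differentiable_near0 (W : normedModType R) (h : V -> W) (x : V) :
  (\forall y \near x, h y = 0) -> differentiable h x.
Proof.
move=> h0.
have hE : h \o shift x = cst (h x) + (\0 : V -> W) +o_ 0 id.
  apply/eqaddoP => _ /posnumP[e]; have := h0.
  rewrite (near_shift 0) subr0; apply: filterS => y /= hy.
  by rewrite !fctE /= hy (nbhs_singleton h0) !addr0 subr0 normr0 mulr_ge0.
have zc : continuous (\0 : V -> W) by move=> y; exact: cvg_cst.
have dh : 'd h x = \0 :> (V -> W).
  by apply: (@diff_unique _ _ _ _ (\0 : {linear V -> W})).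
by apply/diff_locallyP; rewrite dh.
Qed.

Lemma near_eq_differentiable (W : normedModType R) (f g : V -> W) (x : V) :
  (\forall y \near x, f y = g y) -> differentiable f x -> differentiable g x.
Proof.
move=> fg df; rewrite (_ : g = f + (g - f)); last by rewrite addrC subrK.
apply: differentiableD => //; apply: differentiable_near0.
by apply: filterS fg => y fgy; rewrite !fctE fgy subrr.
Qed.

Lemma Ck_subset (W : normedModType R) k (A B : set V) (f : V -> W) :
  B `<=` A -> Ck k A f -> Ck k B f.
Proof.
move=> BA; elim: k f => [|k IH] f /=; first by move=> cf x /BA; exact: cf.
by move=> [df Df]; split=> [x /BA|v]; [exact: df|exact: IH].
Qed.

Variables (A : set V) (oA : open A).

Lemma open_near_eq (T : Type) (f g : V -> T) :
  (forall x, A x -> f x = g x) -> forall x, A x -> \forall y \near x, f y = g y.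
Proof.
move=> fg x Ax; have : nbhs x A by exact: open_nbhs_nbhs.
exact: filterS.
Qed.

(** On an open set, equality on [A] is equality near each point of [A], so it passes to all
    directional derivatives. The differentiation rules, which hold on [A] only, can thus be used
    inside the inductions on the order. *)
Lemma Ck_eq (W : normedModType R) k (f g : V -> W) :
  (forall x, A x -> f x = g x) -> Ck k A f -> Ck k A g.
Proof.
elim: k f g => [|k IH] f g fg /=.
  move=> cf x Ax; rewrite /prop_for /continuous_at -(fg _ Ax).
  apply: cvg_trans (cf _ Ax); apply: near_eq_cvg.
  by have := open_near_eq fg Ax; apply: filterS.
move=> [df Df]; split=> [x Ax|v].
  exact: near_eq_differentiable (open_near_eq fg Ax) (df _ Ax).
apply: IH (Df v) => x Ax; apply: near_eq_derive; exact: open_near_eq.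
Qed.

Lemma Ck_pred (W : normedModType R) k (f : V -> W) : Ck k.+1 A f -> Ck k A f.
Proof.
elim: k f => [|k IH] f [df Df]; first by move=> x /df /differentiable_continuous.
by split=> // v; apply: IH; exact: Df.
Qed.

Lemma Ck_cst (W : normedModType R) k (a : W) : Ck k A (cst a : V -> W).
Proof.
elim: k a => [|k IH] a /=; first by move=> x _; exact: cvg_cst.
split=> [x _|v]; first exact: differentiable_cst.
by rewrite (_ : (fun x => _) = cst 0) //; apply/funext => x; rewrite derive_cst.
Qed.

Lemma CkD (W : normedModType R) k (f g : V -> W) :
  Ck k A f -> Ck k A g -> Ck k A (fun x => f x + g x).
Proof.
elim: k f g => [|k IH] f g /=.
  by move=> cf cg x Ax; apply: cvgD; [exact: cf|exact: cg].
move=> [df Df] [dg Dg]; split=> [x Ax|v].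
  by apply: differentiableD; [exact: df|exact: dg].
apply: Ck_eq (IH _ _ (Df v) (Dg v)) => x Ax.
by rewrite deriveD//; apply: diff_derivable; [exact: df|exact: dg].
Qed.

Lemma CkM k (f g : V -> R^o) :
  Ck k A f -> Ck k A g -> Ck k A (fun x => f x * g x : R^o).
Proof.
elim: k f g => [|k IH] f g.
  by move=> cf cg x Ax; apply: cvgM; [exact: cf|exact: cg].
move=> Cf Cg; have [[df Df] [dg Dg]] := (Cf, Cg); split=> [x Ax|v].
  by apply: differentiableM; [exact: df|exact: dg].
apply: Ck_eq (CkD (IH _ _ (Ck_pred Cf) (Dg v)) (IH _ _ (Ck_pred Cg) (Df v))).
move=> x Ax; rewrite [RHS]deriveM//; apply: diff_derivable.
  exact: df.
exact: dg.
Qed.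

(** The derivative of [1/f] is [-(1/f)^2] times that of [f]. It contains [1/f] again, but only to
    the lower order supplied by the induction hypothesis. *)
Lemma CkV k (f : V -> R^o) : (forall x, A x -> f x != 0) ->
  Ck k A f -> Ck k A (fun x => (f x)^-1 : R^o).
Proof.
move=> f0; elim: k => [|k IH].
  by move=> cf x Ax; apply: (@cvgV R); [exact: f0|exact: cf].
move=> Cf; have [df Df] := Cf; split=> [x Ax|v].
  by apply: differentiableV; [exact: df|exact: f0].
have Ci := IH (Ck_pred Cf).
apply: Ck_eq (CkM (CkM (Ck_cst k (-1 : R^o)) (CkM Ci Ci)) (Df v)) => x Ax.
rewrite [RHS]deriveV; [|exact: f0|by apply: diff_derivable; exact: df].
by rewrite /cst mulN1r -exprVn expr2.
Qed.

Lemma smooth_eq (W : normedModType R) (f g : V -> W) :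
  (forall x, A x -> f x = g x) -> smooth_on A f -> smooth_on A g.
Proof. by move=> fg Cf k; exact: Ck_eq (Cf k). Qed.

Lemma smooth_cst (W : normedModType R) (a : W) : smooth_on A (fun=> a).
Proof. by move=> k; exact: Ck_cst. Qed.

Lemma smoothD (W : normedModType R) (f g : V -> W) :
  smooth_on A f -> smooth_on A g -> smooth_on A (fun x => f x + g x).
Proof. by move=> Cf Cg k; exact: CkD. Qed.

Lemma smoothM (f g : V -> R^o) :
  smooth_on A f -> smooth_on A g -> smooth_on A (fun x => f x * g x : R^o).
Proof. by move=> Cf Cg k; exact: CkM. Qed.

Lemma smoothV (f : V -> R^o) : (forall x, A x -> f x != 0) ->
  smooth_on A f -> smooth_on A (fun x => (f x)^-1 : R^o).
Proof. by move=> f0 Cf k; exact: CkV. Qed.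

Lemma smoothN (f : V -> R^o) :
  smooth_on A f -> smooth_on A (fun x => - f x : R^o).
Proof.
move=> Cf; apply: smooth_eq (smoothM (smooth_cst (-1 : R^o)) Cf) => x _.
by rewrite mulN1r.
Qed.

Lemma smoothB (f g : V -> R^o) :
  smooth_on A f -> smooth_on A g -> smooth_on A (fun x => f x - g x : R^o).
Proof. by move=> Cf Cg; apply: smoothD => //; exact: smoothN. Qed.

Lemma smooth_sum (W : normedModType R) (I : Type) (s : seq I) (P : pred I)
    (F : I -> V -> W) :
  (forall i, smooth_on A (F i)) -> smooth_on A (fun x => \sum_(i <- s | P i) F i x).
Proof.
move=> CF; elim: s => [|i s IH].
  by apply: (@smooth_eq _ (fun=> 0)) (smooth_cst _) => x _; rewrite big_nil.
case Pi : (P i).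
  by apply: smooth_eq (smoothD (CF i) IH) => x _; rewrite big_cons Pi.
by apply: smooth_eq IH => x _; rewrite big_cons Pi.
Qed.

Lemma smooth_prod (I : Type) (s : seq I) (F : I -> V -> R^o) :
  (forall i, smooth_on A (F i)) ->
  smooth_on A (fun x => \prod_(i <- s) F i x : R^o).
Proof.
move=> CF; elim: s => [|i s IH].
  by apply: (@smooth_eq R^o (fun=> 1)) (smooth_cst _) => x _; rewrite big_nil.
by apply: smooth_eq (smoothM (CF i) IH) => x _; rewrite big_cons.
Qed.

Lemma smooth_scaler (W : normedModType R) (f : V -> R^o) (a : W) :
  smooth_on A f -> smooth_on A (fun x => f x *: a).
Proof.
move=> Cf k; have {Cf} := Cf k; elim: k f => [|k IH] f /=.
  by move=> cf x Ax; apply: cvgZr_tmp; exact: cf.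
move=> [df Df]; split=> [x Ax|v]; first exact: differentiableZl (df _ Ax).
apply: Ck_eq (IH _ (Df v)) => x Ax.
rewrite (deriveE v (df _ Ax)) (deriveE v (differentiableZl a (df _ Ax))).
by rewrite (diffZl a (df _ Ax)).
Qed.

Lemma smooth_entry m n (f : V -> 'M[R]_(m, n)) i j :
  smooth_on A f -> smooth_on A (fun x => f x i j : R^o).
Proof.
move=> Cf k; have {Cf} := Cf k; elim: k f => [|k IH] f /=.
  move=> cf x Ax; apply: (@cvg_comp _ _ _ f (fun N : 'M[R]_(m, n) => N i j)).
    exact: cf.
  exact: coord_continuous.
move=> [df Df]; split=> [x Ax|v].
  exact: differentiable_comp (df _ Ax) (differentiable_coord _ _ _).
apply: Ck_eq (IH _ (Df v)) => x Ax.
rewrite derive_mx ?mxE//; apply: diff_derivable; exact: df.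
Qed.

Lemma smooth_row n (f : V -> 'rV[R]_n) :
  (forall i, smooth_on A (fun x => f x 0 i : R^o)) -> smooth_on A f.
Proof.
move=> Cf.
apply: (@smooth_eq _ (fun x => \sum_i f x 0 i *: delta_mx 0 i)) => [x _|].
  by rewrite -row_sum_delta.
by apply: smooth_sum => i; exact: smooth_scaler.
Qed.

Definition smooth_mx m n (F : V -> 'M[R]_(m, n)) : Prop :=
  forall i j, smooth_on A (fun x => F x i j : R^o).

Lemma smooth_mulmx m n p (F : V -> 'M[R]_(m, n)) (G : V -> 'M[R]_(n, p)) :
  smooth_mx F -> smooth_mx G -> smooth_mx (fun x => F x *m G x).
Proof.
move=> CF CG i k; apply: smooth_eq (smooth_sum _ _ _) => [x _|j].
  by rewrite mxE; reflexivity.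
by apply: smoothM.
Qed.

Lemma smooth_det n (F : V -> 'M[R]_n) :
  smooth_mx F -> smooth_on A (fun x => \det (F x) : R^o).
Proof.
move=> CF; apply: smooth_sum => s.
by apply: smoothM; [exact: smooth_cst|apply: smooth_prod => i; exact: CF].
Qed.

(** By Cramer's rule the entries of the inverse are cofactors divided by the determinant. *)
Lemma smooth_invmx n (F : V -> 'M[R]_n) :
  (forall x, A x -> F x \in unitmx) -> smooth_mx F ->
  smooth_mx (fun x => invmx (F x)).
Proof.
move=> uF CF i j.
apply: (@smooth_eq _ (fun x => (\det (F x))^-1 * cofactor (F x) j i)).
  by move=> x Ax; rewrite /invmx uF// !mxE.
apply: smoothM.
  apply: smoothV; last exact: smooth_det.
  by move=> x Ax; have := uF x Ax; rewrite unitmxE unitfE.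
apply: smoothM; first exact: smooth_cst.
apply: smooth_det => a b.
by apply: smooth_eq (CF (lift j a) (lift i b)) => x _; rewrite !mxE.
Qed.

Lemma smooth_trmx m n (F : V -> 'M[R]_(m, n)) :
  smooth_mx F -> smooth_mx (fun x => (F x)^T).
Proof. by move=> CF i j; apply: smooth_eq (CF j i) => x _; rewrite mxE. Qed.

End SmoothFunctions.

(** If [z] is in the left kernel of [N *m N^T], then the squared norm of [z *m N] is 0, hence so is
    [z]. This gives [N] the right inverse [N^T *m invmx (N *m N^T)], built from the entries of [N]
    by rational operations. *)
Lemma gram_unitmx (R : realFieldType) m n (N : 'M[R]_(m, n)) :
  (forall z : 'rV[R]_m, z *m N = 0 -> z = 0) -> N *m N^T \in unitmx.
Proof.
move=> Ninj; rewrite -row_free_unit -kermx_eq0; apply/eqP/row_matrixP => i.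
rewrite row0; set z := row i _.
have zN : z *m (N *m N^T) = 0.
  by apply/sub_kermxP; exact: row_sub.
apply: Ninj; set y := z *m N.
have yy : y *m y^T = 0 by rewrite trmx_mul mulmxA -(mulmxA z) zN mul0mx.
clearbody y; move: yy => /matrixP/(_ 0 0); rewrite !mxE => /eqP.
rewrite psumr_eq0; last by move=> j _; rewrite mxE -expr2 sqr_ge0.
move=> /allP y0; apply/rowP => j; have /y0 := mem_index_enum j.
by rewrite !mxE mulf_eq0 orbb => /eqP.
Qed.

(** * The forms phi0 and its Hodge dual on R^7 *)

Section Minors.
Variable R : comNzRingType.

(** Entries indexed by natural numbers let an expansion along the first row be evaluated by
    computation. In the minors, [bump j] skips the deleted column [j]. *)
Definition detf n (A : nat -> nat -> R) : R := \det (\matrix_(i < n, j < n) A i j).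

Lemma detf0 A : detf 0 A = 1. Proof. exact: det_mx00. Qed.

Lemma detfS n A : detf n.+1 A =
  \sum_(0 <= j < n.+1) (-1) ^+ j * A 0 j * detf n (fun i k => A i.+1 (bump j k)).
Proof.
rewrite big_mkord /detf (expand_det_row _ ord0); apply: eq_bigr => j _.
rewrite mxE /cofactor add0n mulrCA mulrA; congr (_ * _ * _).
by congr (\det _); apply/matrixP => a b; rewrite !mxE.
Qed.

(** Used to strip the rows [e_i], [e_j], [e_k] from the determinants in the Hodge star. *)
Lemma detf_delta n A c : (c < n.+1)%N ->
  (forall j, (j < n.+1)%N -> A 0 j = (j == c)%:R) ->
  detf n.+1 A = (-1) ^+ c * detf n (fun i k => A i.+1 (bump c k)).
Proof.
move=> cn A0; rewrite detfS big_mkord (bigD1 (Ordinal cn))//=.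
rewrite A0// eqxx mulr1 big1 ?addr0// => j jc.
by rewrite A0// -val_eqE in jc *; rewrite (negPf jc) mulr0 mul0r.
Qed.

Lemma detf3E A : detf 3 A = A 0 0 * (A 1 1 * A 2 2 - A 1 2 * A 2 1)
  - A 0 1 * (A 1 0 * A 2 2 - A 1 2 * A 2 0)
  + A 0 2 * (A 1 0 * A 2 1 - A 1 1 * A 2 0).
Proof.
do 3!rewrite !detfS unlock /= !addr0.
by rewrite !detf0 /bump /=; ring.
Qed.

Lemma detf4E A : detf 4 A =
  A 0 0 * detf 3 (fun i k => A i.+1 (bump 0 k))
  - A 0 1 * detf 3 (fun i k => A i.+1 (bump 1 k))
  + A 0 2 * detf 3 (fun i k => A i.+1 (bump 2 k))
  - A 0 3 * detf 3 (fun i k => A i.+1 (bump 3 k)).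
Proof. by rewrite detfS unlock /= addr0; ring. Qed.
End Minors.

Section Euclidean7.
Variable R : realType.
Local Notation V := 'rV[R]_7.

Definition e7 (i : nat) : V := delta_mx 0 (inord i).
Definition co (i : nat) (x : V) : R := x 0 (inord i).

Lemma co_e7 i j : (i < 7)%N -> (j < 7)%N -> co i (e7 j) = (i == j)%:R.
Proof. by move=> i7 j7; rewrite /co mxE eqxx /= -val_eqE /= !inordK. Qed.

Lemma dot7E x y : dot7 x y = co 0 x * co 0 y + co 1 x * co 1 y + co 2 x * co 2 y
  + co 3 x * co 3 y + co 4 x * co 4 y + co 5 x * co 5 y + co 6 x * co 6 y.
Proof.
have -> : dot7 x y = \sum_(i < 7) co i x * co i y.
  by apply: eq_bigr => i _; rewrite /co inord_val.
by rewrite !big_ord_recr big_ord0 /= add0r.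
Qed.

Lemma wedge3E i j k x y z : wedge3 i j k x y z =
  dx i x * (dx j y * dx k z - dx k y * dx j z)
  - dx j x * (dx i y * dx k z - dx k y * dx i z)
  + dx k x * (dx i y * dx j z - dx j y * dx i z) :> R.
Proof.
rewrite -[LHS]/(detf 3 (fun r s =>
  dx (nth 0%N [:: i; j; k] s) (nth 0 [:: x; y; z] r))).
by rewrite detf3E /=; ring.
Qed.

Definition cross0 (x y : V) : V := \row_i phi0 x y (delta_mx 0 i).

Lemma cross0_e (x y : V) (i : nat) : co i (cross0 x y) = phi0 x y (e7 i).
Proof. by rewrite /co mxE. Qed.

(* [phi0 x y e_i] in terms of the coordinates of [x] and [y]. *)
Definition cross0E (x y : nat -> R) : nat -> R := nth 0%R
  [:: (x 1 * y 2 - x 2 * y 1) + (x 3 * y 4 - x 4 * y 3) + (x 5 * y 6 - x 6 * y 5);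
   (x 2 * y 0 - x 0 * y 2) + (x 3 * y 5 - x 5 * y 3) - (x 4 * y 6 - x 6 * y 4);
   (x 0 * y 1 - x 1 * y 0) - (x 3 * y 6 - x 6 * y 3) - (x 4 * y 5 - x 5 * y 4);
   (x 4 * y 0 - x 0 * y 4) + (x 5 * y 1 - x 1 * y 5) - (x 6 * y 2 - x 2 * y 6);
   (x 0 * y 3 - x 3 * y 0) - (x 6 * y 1 - x 1 * y 6) - (x 5 * y 2 - x 2 * y 5);
   (x 6 * y 0 - x 0 * y 6) + (x 1 * y 3 - x 3 * y 1) - (x 2 * y 4 - x 4 * y 2);
   (x 0 * y 5 - x 5 * y 0) - (x 1 * y 4 - x 4 * y 1) - (x 2 * y 3 - x 3 * y 2)].

Lemma phi0_cross0E x y z :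
  phi0 x y z = \sum_(i < 7) cross0E (co^~ x) (co^~ y) i * co i z.
Proof.
rewrite !big_ord_recr big_ord0 /= /phi0 !wedge3E /dx /= -!/(co _ _) /cross0E /=.
by ring.
Qed.

Lemma co_cross0 x y i : (i < 7)%N ->
  co i (cross0 x y) = cross0E (co^~ x) (co^~ y) i.
Proof.
move=> i7; rewrite cross0_e phi0_cross0E (bigD1 (Ordinal i7))//= co_e7// eqxx.
rewrite mulr1 big1 ?addr0// => j ji.
by rewrite co_e7 ?ltn_ord// -val_eqE in ji *; rewrite (negPf ji) mulr0.
Qed.

Lemma dot_cross0 x y z : dot7 (cross0 x y) z = phi0 x y z.
Proof.
rewrite phi0_cross0E; apply: eq_bigr => i _.
by rewrite -co_cross0// /co inord_val.
Qed.

(** This is the polarisation of x * (x * z) = <x,z> x - <x,x> z, checked as a polynomial identity in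
    the coordinates. *)
Lemma cross0_cross0 x y z t : dot7 (cross0 x (cross0 y z)) t
   + dot7 (cross0 y (cross0 x z)) t
  = - (2 * dot7 x y * dot7 z t) + dot7 x z * dot7 y t + dot7 y z * dot7 x t.
Proof.
rewrite !dot7E !co_cross0// /cross0E !co_cross0// /cross0E /=.
by ring.
Qed.

Lemma phi0_e7 i j k : (i < 7)%N -> (j < 7)%N -> (k < 7)%N ->
  phi0 (e7 i) (e7 j) (e7 k) =
  cross0E (fun a => (a == i)%:R) (fun a => (a == j)%:R) k.
Proof.
move=> i7 j7 k7; rewrite -cross0_e co_cross0// /cross0E.
by rewrite !co_e7.
Qed.

Lemma hodge_sum_phi0 (F : nat -> nat -> nat -> R) :
  \sum_(i < 7) \sum_(j < 7 | (i < j)%N) \sum_(k < 7 | (j < k)%N)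
    phi0 (e7 i) (e7 j) (e7 k) * F i j k =
  F 0 1 2 + F 0 3 4 + F 0 5 6 + F 1 3 5 - F 1 4 6 - F 2 3 6 - F 2 4 5.
Proof.
pose G i j k := phi0 (e7 i) (e7 j) (e7 k) * F i j k.
have GE i j k : (i < 7)%N -> (j < 7)%N -> (k < 7)%N -> G i j k =
    cross0E (fun a => (a == i)%:R) (fun a => (a == j)%:R) k * F i j k.
  by move=> *; rewrite /G phi0_e7.
transitivity (\sum_(0 <= i < 7) \sum_(0 <= j < 7 | (i < j)%N)
    \sum_(0 <= k < 7 | (j < k)%N) G i j k).
  rewrite big_mkord; apply: eq_bigr => i _; rewrite big_mkord.
  by apply: eq_bigr => j _; rewrite big_mkord.
(* With [G] opaque the sums unfold to the list of increasing triples; [GE] then evaluates each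
   coefficient of [phi0], and only seven are nonzero. *)
clearbody G; rewrite unlock /= !addr0 !GE// /cross0E /=.
by ring.
Qed.

(** Only the seven index triples of [phi0] contribute. Each leaves a signed 4 by 4 minor of the rows
    [x], [y], [z], [t], and what remains is a polynomial identity. *)
Lemma hodge3_phi0 x y z t : hodge3 (@phi0 R) x y z t =
  - dot7 (cross0 x (cross0 y z)) t - dot7 x y * dot7 z t + dot7 x z * dot7 y t.
Proof.
pose A i j k r c := co c (nth 0 [:: e7 i; e7 j; e7 k; x; y; z; t] r).
have -> : hodge3 (@phi0 R) x y z t = \sum_(i < 7) \sum_(j < 7 | (i < j)%N)
    \sum_(k < 7 | (j < k)%N) phi0 (e7 i) (e7 j) (e7 k) * detf 7 (A i j k).
  apply: eq_bigr => i _; apply: eq_bigr => j _; apply: eq_bigr => k _.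
  rewrite /e7 !inord_val; congr (_ * \det _).
  by apply/matrixP => r c; rewrite !mxE /A /co /e7 !inord_val.
pose B i j k r c := co (bump i (bump j (bump k c))) (nth 0 [:: x; y; z; t] r).
(* Once column [i] is deleted, column [j] has index [j.-1]; once both are deleted, column [k] has
   index [k.-2]. The nested [bump]s in [B] restore the original column numbers. *)
have detA i j k : (i < j < k)%N -> (k < 7)%N ->
    detf 7 (A i j k) = (-1) ^+ (i + j.-1 + k.-2) * detf 4 (B i j.-1 k.-2).
  move=> /andP[ij jk] k7; rewrite (@detf_delta _ _ _ i); [|lia|]; last first.
    by move=> c c7; rewrite /A/= co_e7//; lia.
  rewrite (@detf_delta _ _ _ j.-1); [|lia|]; last first.
    move=> c c6; rewrite /A/= co_e7; [|by rewrite /bump; lia|lia].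
    by congr (_%:R); rewrite /bump; apply/eqP/eqP; lia.
  rewrite (@detf_delta _ _ _ k.-2); [|lia|]; last first.
    move=> c c6; rewrite /A/= co_e7; [|by rewrite /bump; lia|lia].
    by congr (_%:R); rewrite /bump; apply/eqP/eqP; lia.
  by rewrite !exprD !mulrA.
rewrite (hodge_sum_phi0 (fun i j k => detf 7 (A i j k))) !detA//.
rewrite !detf4E !detf3E /B /bump /=.
rewrite !dot7E !co_cross0// /cross0E !co_cross0// /cross0E /=.
by ring.
Qed.

Lemma dot7C x y : dot7 x y = dot7 y x :> R.
Proof. by apply: eq_bigr => i _; rewrite mulrC. Qed.

Lemma dot7Pl k x y z : dot7 (k *: x + y) z = k * dot7 x z + dot7 y z :> R.
Proof.
rewrite /dot7 mulr_sumr -big_split; apply: eq_bigr => i _ /=.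
by rewrite !mxE mulrDl mulrA.
Qed.

Lemma dot7_eq0 x : dot7 x x = 0 :> R -> x = 0.
Proof.
move/eqP; rewrite psumr_eq0 => [/allP x0|i _]; last by rewrite -expr2 sqr_ge0.
apply/rowP => i; have := x0 i (mem_index_enum i).
by rewrite mulf_eq0 orbb mxE => /eqP.
Qed.

Lemma phi0_alt x y : phi0 x y y = 0 :> R /\ phi0 x x y = 0 :> R.
Proof. by split; rewrite /phi0 !wedge3E; ring. Qed.

Lemma phi0C x y z : phi0 y x z = - phi0 x y z :> R.
Proof. by rewrite /phi0 !wedge3E; ring. Qed.

Lemma phi0_cycle x y z : phi0 x y z = phi0 y z x :> R.
Proof. by rewrite /phi0 !wedge3E; ring. Qed.

Lemma phi0Pl k x x' y z : phi0 (k *: x + x') y z = k * phi0 x y z + phi0 x' y z :> R.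
Proof. by rewrite phi0_cycle -dot_cross0 dot7C dot7Pl !(dot7C _ (cross0 _ _))
  !dot_cross0 -!(phi0_cycle _ y z). Qed.

End Euclidean7.

(** * Spans *)

Section Span.
Variables (R : realType) (V : lmodType R).
Implicit Types (A B : set V) (x y : V).

Lemma lspan_gen A x : A x -> lspan A x.
Proof.
move=> Ax; exists 1%N, (fun=> 1), (fun=> x); split=> //.
by rewrite big_ord1 scale1r.
Qed.

Lemma lspanZ A k x : lspan A x -> lspan A (k *: x).
Proof.
move=> [n [a [g [Ag ->]]]]; exists n, (fun i => k * a i), g; split=> //.
by rewrite scaler_sumr; apply: eq_bigr => i _; rewrite scalerA.
Qed.

Lemma lspanD A x y : lspan A x -> lspan A y -> lspan A (x + y).
Proof.
move=> [n [a [g [Ag ->]]]] [m [c [h [Ah ->]]]]; exists (n + m)%N.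
exists (fun i => match fintype.split i with inl j => a j | inr j => c j end).
exists (fun i => match fintype.split i with inl j => g j | inr j => h j end).
split=> [i|]; first by case: fintype.split.
rewrite big_split_ord /=; congr (_ + _); apply: eq_bigr => i _.
  by rewrite -[lshift _ _]/(unsplit (inl i)) unsplitK.
by rewrite -[rshift _ _]/(unsplit (inr i)) unsplitK.
Qed.

Lemma lspan_min A B : A `<=` B -> B 0 ->
  (forall x y, B x -> B y -> B (x + y)) -> (forall k x, B x -> B (k *: x)) ->
  lspan A `<=` B.
Proof.
move=> AB B0 BD BZ _ [n [a [g [Ag ->]]]].
by elim/big_ind: _ => // i _; apply/BZ/AB.
Qed.

Lemma lspan_comb0 A x y z a b c :
  comb0 x y z `<=` A -> a + b + c = 0 -> lspan A (a *: x + b *: y + c *: z).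
Proof. by move=> CA abc; apply/lspan_gen/CA; exists a, b, c. Qed.

(** Subtracting the mean [m] from the three coefficients makes their sum 0 and splits off a multiple
    of [x + y + z]. *)
Lemma lspan_comb A s x y z a b c : s != 0 ->
  comb0 x y z `<=` A -> A (s *: (x + y + z)) ->
  lspan A (a *: x + b *: y + c *: z).
Proof.
move=> s0 CA As; pose m := (a + b + c) / 3.
have -> : a *: x + b *: y + c *: z = (a - m) *: x + (b - m) *: y + (c - m) *: z
    + (m / s) *: (s *: (x + y + z)).
  rewrite scalerA divfK// !scalerDr addrACA.
  by rewrite [X in _ = X + _]addrACA -!scalerDl !subrK.
apply: lspanD; last exact/lspanZ/lspan_gen.
by apply: lspan_comb0 => //; rewrite /m; field.
Qed.
End Span.

(** * Algebra in a tangent space *)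

Section G2Tangent.
Variables (R : realType) (M : smooth_manifold R 7) (phi : G2_structure M).
Variable p : M.
Local Notation T := (tangent p).
Local Notation A := (G2_frame_at phi p).
Local Notation dot := (@metric R M phi p).
Local Notation "x ×× y" := (@cross R M phi p x y) (at level 40, left associativity).
Local Notation form := (@G2_form R M phi p).
Implicit Types x y z t : T.

Lemma frame_inj : injective A.
Proof. exact: can_inj (frame_coordK A). Qed.

Lemma metricC x y : dot x y = dot y x. Proof. exact: dot7C. Qed.

Lemma metricPl k x y z : dot (k *: x + y) z = k * dot x z + dot y z.
Proof. by rewrite /metric linearP dot7Pl. Qed.

Lemma metricDl x y z : dot (x + y) z = dot x z + dot y z.
Proof. by rewrite -[x]scale1r metricPl scale1r mul1r. Qed.

Lemma metric0l z : dot 0 z = 0.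
Proof. by apply: (addrI (dot 0 z)); rewrite -metricDl !addr0. Qed.

Lemma metricZl k x z : dot (k *: x) z = k * dot x z.
Proof. by rewrite -[k *: x]addr0 metricPl metric0l addr0. Qed.

Lemma metricNl x z : dot (- x) z = - dot x z.
Proof. by rewrite -scaleN1r metricZl mulN1r. Qed.

Lemma metricDr x y z : dot z (x + y) = dot z x + dot z y.
Proof. by rewrite !(metricC z) metricDl. Qed.

Lemma metricZr k x z : dot z (k *: x) = k * dot z x.
Proof. by rewrite !(metricC z) metricZl. Qed.

Lemma metric_eq0 x : dot x x = 0 -> x = 0.
Proof. by move=> /dot7_eq0 Ax0; apply: frame_inj; rewrite Ax0 linear0. Qed.

Lemma metric_ext x y : (forall z, dot x z = dot y z) -> x = y.
Proof.
move=> xy; apply/subr0_eq/metric_eq0.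
by rewrite metricDl metricNl xy subrr.
Qed.

Lemma metric_cross x y z : dot (x ×× y) z = form x y z.
Proof.
(* The vector with frame coordinates [cross0 (A x) (A y)] satisfies the defining property, so the
   default value 0 of the choice never occurs. *)
rewrite /cross; case: xgetP => [v -> //|] /(_ (frame_vec A (cross0 (A x) (A y)))).
by case=> t; rewrite /metric frame_vecK dot_cross0 (frame_phi A).
Qed.

Lemma frame_cross x y : A (x ×× y) = cross0 (A x) (A y).
Proof.
rewrite -[RHS](frame_vecK A); congr (A _); apply: metric_ext => z.
by rewrite metric_cross /metric frame_vecK dot_cross0 (frame_phi A).
Qed.

Lemma form_cycle x y z : form x y z = form y z x.
Proof. by rewrite !(frame_phi A); exact: phi0_cycle. Qed.

Lemma formC x y z : form y x z = - form x y z.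
Proof. by rewrite !(frame_phi A); exact: phi0C. Qed.

Lemma formPl k x y z t : form (k *: x + y) z t = k * form x z t + form y z t.
Proof. by rewrite !(frame_phi A) linearP phi0Pl. Qed.

Lemma crossPl k x y z : (k *: x + y) ×× z = k *: (x ×× z) + y ×× z.
Proof.
by apply: metric_ext => t; rewrite metricPl !metric_cross formPl.
Qed.

Lemma crossC x y : y ×× x = - (x ×× y).
Proof. by apply: metric_ext => t; rewrite metricNl !metric_cross formC. Qed.

Lemma crossDl x y z : (x + y) ×× z = x ×× z + y ×× z.
Proof. by rewrite -[x]scale1r crossPl !scale1r. Qed.

Lemma cross0l z : 0 ×× z = 0.
Proof. by apply: (addrI (0 ×× z)); rewrite -crossDl !addr0. Qed.

Lemma crossZl k x z : (k *: x) ×× z = k *: (x ×× z).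
Proof. by rewrite -[k *: x]addr0 crossPl cross0l addr0. Qed.

Lemma crossNl x z : (- x) ×× z = - (x ×× z).
Proof. by rewrite -scaleN1r crossZl scaleN1r. Qed.

Lemma crossDr x y z : z ×× (x + y) = z ×× x + z ×× y.
Proof. by rewrite !(crossC _ z) crossDl opprD. Qed.

Lemma crossZr k x z : z ×× (k *: x) = k *: (z ×× x).
Proof. by rewrite !(crossC _ z) crossZl scalerN. Qed.

Lemma crossNr x z : z ×× (- x) = - (z ×× x).
Proof. by rewrite !(crossC _ z) crossNl. Qed.

Lemma crossxx x : x ×× x = 0.
Proof.
apply: metric_ext => t.
by rewrite metric_cross metric0l (frame_phi A) (phi0_alt _ _).2.
Qed.

Lemma form_alt x y : (form x y y = 0) * (form x x y = 0) * (form x y x = 0).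
Proof.
by rewrite !(frame_phi A) (phi0_cycle (A x) (A y) (A x)) !(phi0_alt _ _).1
  (phi0_alt _ _).2.
Qed.

Lemma cross_cross x y z : x ×× (y ×× z) + y ×× (x ×× z) =
  - (2 * dot x y) *: z + dot x z *: y + dot y z *: x.
Proof.
apply: metric_ext => t.
rewrite !metricDl !metricZl /metric !frame_cross cross0_cross0.
by rewrite mulNr.
Qed.

(** The case of two equal vectors in [cross_cross], halved. *)
Lemma cross_sqr x y : x ×× (x ×× y) = dot x y *: x - dot x x *: y.
Proof.
apply: (scalerI (a := 2 : R)); first by rewrite pnatr_eq0.
rewrite [LHS]scaler_nat mulr2n cross_cross -addrA -scalerDl -mulr2n.
by rewrite scalerBr !scalerA !mulr_natl scaleNr addrC.
Qed.

(** The vector [c] below represents [star_phi x y z] by [hodge3_phi0], so the choice defining [chi]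
    succeeds, and nondegeneracy of the metric makes its result equal to [c]. *)
Lemma chiE x y z :
  chi phi x y z = - (x ×× (y ×× z)) - dot x y *: z + dot x z *: y.
Proof.
pose c := - (x ×× (y ×× z)) - dot x y *: z + dot x z *: y.
have hc t : dot c t = star_phi phi x y z t.
  rewrite /star_phi (_ : (fun a b d => _) = @phi0 R); last first.
    by apply/funext => a; apply/funext => b; apply/funext => d;
       rewrite (frame_phi A) !frame_vecK.
  rewrite hodge3_phi0 !metricDl !metricNl !metricZl /metric.
  by rewrite !frame_cross.
rewrite /chi; case: xgetP => [v -> hv|/(_ c)/(_ hc)//].
by apply: metric_ext => t; rewrite hv -hc.
Qed.

(** In frame coordinates the seven vectors form a square matrix [Q] with [Q *m Q^T = 1]. Then
    [Q^T *m Q = 1] as well, which is the expansion. *)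
Lemma orthonormal_expansion (b : 'I_7 -> T) :
  (forall i j, dot (b i) (b j) = (i == j)%:R) ->
  forall z, z = \sum_i dot z (b i) *: b i.
Proof.
move=> ob z; apply: frame_inj; rewrite linear_sum.
pose Q : 'M[R]_7 := \matrix_i A (b i).
have QQ : Q *m Q^T = 1%:M.
  apply/matrixP => i j; rewrite !mxE -ob; apply: eq_bigr => k _.
  by rewrite !mxE.
rewrite -[LHS]mulmx1 -(mulmx1C QQ) mulmxA mulmx_sum_row; apply: eq_bigr => i _.
rewrite linearZ rowK; congr (_ *: _).
by rewrite !mxE; apply: eq_bigr => k _; rewrite !mxE.
Qed.

(** Such a triple spans, together with u * (v * w), a 4-plane on which [form] vanishes, that is, a
    coassociative plane. The conditions are listed in cyclic order to match [triple_cycle]. *)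
Definition coassociative_triple (u v w : T) : Prop :=
  [/\ dot u u = 1, dot v v = 1 & dot w w = 1] /\
  [/\ dot u v = 0, dot v w = 0, dot w u = 0 & form u v w = 0].

(** * Multiplication table and Gram matrix generated by a triple *)

Section Triple.
Variables u v w : T.
Hypothesis uvw : coassociative_triple u v w.

(** Each relation below need only be proved for one pair; the other two cases come from the cyclic
    shifts. *)
Lemma triple_cycle : coassociative_triple v w u.
Proof.
case: uvw => [[uu vv ww] [uv vw wu f]].
by split; split=> //; rewrite -form_cycle.
Qed.

Lemma triple_cross_l : u ×× (u ×× v) = - v.
Proof.
case: uvw => [[uu _ _] [uv _ _ _]].
by rewrite cross_sqr uv uu scale0r scale1r sub0r.
Qed.

Lemma triple_cross_r : v ×× (u ×× v) = u.
Proof.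
case: uvw => [[_ vv _] [uv _ _ _]].
rewrite (crossC v u) crossNr cross_sqr (metricC v).
by rewrite uv vv scale0r scale1r sub0r opprK.
Qed.

(** By [cross_cross], u * (v * w) changes sign when two orthogonal vectors [u], [v], both orthogonal
    to [w], are exchanged. Hence R is the same for all cyclic shifts of the triple. *)
Lemma triple_cross_swap : v ×× (w ×× u) = u ×× (v ×× w).
Proof.
case: uvw => [[uu vv ww] [uv vw wu f]].
have /eqP := cross_cross v u w; rewrite (metricC u w) (metricC v u) uv vw wu.
rewrite !(mulr0, scale0r, oppr0, addr0) addrC addr_eq0 => /eqP ->.
by rewrite (crossC u w) crossNr.
Qed.

End Triple.

Section TripleTable.
Variables u v w : T.
Hypothesis uvw : coassociative_triple u v w.
Let vwu : coassociative_triple v w u := triple_cycle uvw.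
Let wuv : coassociative_triple w u v := triple_cycle vwu.
Let r := - (u ×× (v ×× w)).

Let rv : - (v ×× (w ×× u)) = r.
Proof. by rewrite /r (triple_cross_swap uvw). Qed.

Let rw : - (w ×× (u ×× v)) = r.
Proof. by rewrite (triple_cross_swap vwu) rv. Qed.

Lemma triple_cross_uR : u ×× r = v ×× w.
Proof.
have [[uu _ _] [uv _ wu f]] := uvw.
rewrite /r crossNr cross_sqr (metricC u) metric_cross -form_cycle f uu.
by rewrite scale0r scale1r sub0r opprK.
Qed.

Lemma triple_cross_planes : (u ×× v) ×× (v ×× w) = - (w ×× u).
Proof.
have [[uu vv ww] [uv vw wu f]] := uvw.
(* The vectors [u ×× v], [w], [v] are pairwise orthogonal, so the right-hand side vanishes; the
   second term on the left is known from [triple_cross_r]. *)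
have /eqP := cross_cross (u ×× v) w v.
rewrite !metric_cross f (metricC w v) vw.
rewrite form_alt !(mulr0, scale0r, oppr0, addr0).
rewrite (crossC v (u ×× v)) (triple_cross_r uvw).
by rewrite crossNr (crossC v w) crossNr -opprD oppr_eq0 addr_eq0 => /eqP.
Qed.

Let ru : dot r u = 0.
Proof. by rewrite /r metricNl metric_cross form_alt oppr0. Qed.

Let rdv : dot r v = 0.
Proof. by rewrite -rv metricNl metric_cross form_alt oppr0. Qed.

Let vR : v ×× r = w ×× u.
Proof.
have [[uu vv _] [uv vw wu f]] := uvw.
rewrite -rv crossNr cross_sqr (metricC v) metric_cross -2!form_cycle f vv.
by rewrite scale0r scale1r sub0r opprK.
Qed.

Lemma triple_cross_R_plane : r ×× (u ×× v) = w.
Proof.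
have [[uu vv _] [uv _ _ _]] := uvw.
have /eqP := cross_cross r u v; rewrite ru rdv uv !(mulr0, scale0r, oppr0, addr0).
rewrite addr_eq0 (crossC v r) vR crossNr (triple_cross_r wuv) opprK => /eqP ->.
by [].
Qed.

(** Inner products with a cross product are values of [form], whose arguments can be rotated until a
    known product appears. With the two cyclic shifts this yields the whole Gram matrix. *)
Lemma triple_metric :
  ((dot u (u ×× v) = 0) * (dot v (u ×× v) = 0) * (dot w (u ×× v) = 0) *
   (dot r u = 0) * (dot r r = 1) * (dot r (u ×× v) = 0) *
   (dot (u ×× v) (u ×× v) = 1) * (dot (u ×× v) (v ×× w) = 0))%type.
Proof.
have [[uu vv ww] [uv vw wu f]] := uvw.
rewrite !(metricC _ (u ×× v)) ru !metric_cross !form_alt f.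
rewrite (form_cycle u v r) -(metric_cross v r) vR metric_cross form_alt.
rewrite (form_cycle u v) -metric_cross (triple_cross_r uvw) uu.
rewrite (form_cycle u v) -metric_cross (triple_cross_l vwu) metricNl wu oppr0.
rewrite {1}/r metricNl metric_cross (form_cycle u) (form_cycle _ r) -metric_cross.
rewrite (crossC u r) triple_cross_uR metricNl opprK metric_cross (form_cycle v).
by rewrite -metric_cross (triple_cross_r vwu) vv.
Qed.

End TripleTable.

(** The octonionic multiplication table of the frame, with [a], [b], [c] standing for u * v, v * w,
    w * u and [r] for R. The seven vectors are independent variables, so the table can serve as a
    rewriting system after the products have been generalised. *)
Definition cross_table (u v w r a b c : T) : Type :=
  (((u ×× v = a) * (v ×× w = b) * (w ×× u = c) *
   (v ×× u = - a) * (w ×× v = - b) * (u ×× w = - c) *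
   (u ×× a = - v) * (v ×× a = u) * (w ×× a = - r) *
   (a ×× u = v) * (a ×× v = - u) * (a ×× w = r) *
   (v ×× b = - w) * (w ×× b = v) * (u ×× b = - r) *
   (b ×× v = w) * (b ×× w = - v) * (b ×× u = r) *
   (w ×× c = - u) * (u ×× c = w) * (v ×× c = - r) *
   (c ×× w = u) * (c ×× u = - w) * (c ×× v = r) *
   (u ×× r = b) * (v ×× r = c) * (w ×× r = a) *
   (r ×× u = - b) * (r ×× v = - c) * (r ×× w = - a) *
   (r ×× a = w) * (r ×× b = u) * (r ×× c = v) *
   (a ×× r = - w) * (b ×× r = - u) * (c ×× r = - v) *
   (a ×× b = - c) * (b ×× c = - a) * (c ×× a = - b) *
   (b ×× a = c) * (c ×× b = a) * (a ×× c = b)) *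
   ((u ×× u = 0) * (v ×× v = 0) * (w ×× w = 0) * (r ×× r = 0) *
    (a ×× a = 0) * (b ×× b = 0) * (c ×× c = 0)))%type.

Lemma cross_tableP u v w : coassociative_triple u v w ->
  cross_table u v w (- (u ×× (v ×× w))) (u ×× v) (v ×× w) (w ×× u).
Proof.
move=> uvw; have vwu := triple_cycle uvw; have wuv := triple_cycle vwu.
set r := - _.
have rv : - (v ×× (w ×× u)) = r by rewrite /r (triple_cross_swap uvw).
have rw : - (w ×× (u ×× v)) = r by rewrite (triple_cross_swap vwu) rv.
have flip x y z : x ×× y = z -> (x ×× y = z) * (y ×× x = - z).
  by move=> <-; rewrite -crossC.
have T1 := flip _ _ _ (triple_cross_l uvw).
have T2 := flip _ _ _ (triple_cross_l vwu).
have T3 := flip _ _ _ (triple_cross_l wuv).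
have T4 := flip _ _ _ (triple_cross_r uvw).
have T5 := flip _ _ _ (triple_cross_r vwu).
have T6 := flip _ _ _ (triple_cross_r wuv).
have T7 := flip _ _ _ (triple_cross_uR uvw).
have T8 := flip _ _ _ (triple_cross_uR vwu).
have T9 := flip _ _ _ (triple_cross_uR wuv).
have T10 := flip _ _ _ (triple_cross_planes uvw).
have T11 := flip _ _ _ (triple_cross_planes vwu).
have T12 := flip _ _ _ (triple_cross_planes wuv).
have T13 := flip _ _ _ (triple_cross_R_plane uvw).
have T14 := flip _ _ _ (triple_cross_R_plane vwu).
have T15 := flip _ _ _ (triple_cross_R_plane wuv).
have T16 := flip _ _ _ (erefl (u ×× v)).
have T17 := flip _ _ _ (erefl (v ×× w)).
have T18 := flip _ _ _ (erefl (w ×× u)).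
have nr x : - x = r -> x = - r by move=> <-; rewrite opprK.
have T19 := flip _ _ _ (nr _ (erefl r)).
have T20 := flip _ _ _ (nr _ rv).
have T21 := flip _ _ _ (nr _ rw).
rewrite -/r ?rv ?rw in T7 T8 T9 T13 T14 T15.
rewrite /cross_table !crossxx; do !split;
  by rewrite ?(T1, T2, T3, T4, T5, T6, T7, T8, T9, T10, T11, T12, T13, T14, T15,
    T16, T17, T18, T19, T20, T21) ?opprK.
Qed.

Lemma triple_orthonormal u v w
    (s := [:: u; v; w; - (u ×× (v ×× w)); u ×× v; v ×× w; w ×× u]) :
  coassociative_triple u v w ->
  forall i j, (i < 7)%N -> (j < 7)%N -> dot (nth 0 s i) (nth 0 s j) = (i == j)%:R.
Proof.
move=> uvw; have vwu := triple_cycle uvw; have wuv := triple_cycle vwu.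
have [[uu vv ww] [uv vw wu _]] := uvw.
rewrite {}/s; set r := - _.
have rv : - (v ×× (w ×× u)) = r by rewrite /r (triple_cross_swap uvw).
have rw : - (w ×× (u ×× v)) = r by rewrite (triple_cross_swap vwu) rv.
have T1 := triple_metric uvw; have T2 := triple_metric vwu.
have T3 := triple_metric wuv; rewrite -/r in T1; rewrite rv in T2; rewrite rw in T3.
have le i j : (i <= j)%N -> (j < 7)%N ->
  dot (nth 0 [:: u; v; w; r; u ×× v; v ×× w; w ×× u] i)
      (nth 0 [:: u; v; w; r; u ×× v; v ×× w; w ×× u] j) = (i == j)%:R.
  move: i j => [|[|[|[|[|[|[|i]]]]]]] [|[|[|[|[|[|[|j]]]]]]]//= _ _;
  rewrite ?uu ?vv ?ww ?uv ?vw ?(metricC u w) ?wu ?(metricC u r) ?(metricC v r)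
    ?(metricC w r) ?(metricC (u ×× v) (w ×× u)) ?T1 ?T2 ?T3//.
move=> i j i7 j7; case: (leqP i j) => [ij|/ltnW ij]; first exact: le.
by rewrite metricC le// eq_sym.
Qed.

Lemma triple_expansion u v w : coassociative_triple u v w ->
  forall z, z = dot z u *: u + dot z v *: v + dot z w *: w
    + dot z (- (u ×× (v ×× w))) *: (- (u ×× (v ×× w)))
    + dot z (u ×× v) *: (u ×× v) + dot z (v ×× w) *: (v ×× w)
    + dot z (w ×× u) *: (w ×× u).
Proof.
move=> uvw z; set r := - _.
pose b (i : 'I_7) : T := nth 0 [:: u; v; w; r; u ×× v; v ×× w; w ×× u] i.
have ob i j : dot (b i) (b j) = (i == j)%:R by exact: triple_orthonormal.
rewrite [LHS](orthonormal_expansion ob).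
by rewrite !big_ord_recr big_ord0 /= add0r.
Qed.

(* Expand [t1], [t2], [t3] in the orthonormal basis [u, v, w, r, u ×× v, v ×× w,
   w ×× u]: the twelve values [form x ti tj] determine the twelve unknown
   coordinates of [t1], [t2], [t3] along [u, v, w, r]. *)
Lemma cross_from_dual u v w t1 t2 t3 (r := - (u ×× (v ×× w))) :
  coassociative_triple u v w ->
  form u v t1 = 1 -> form v w t1 = 0 -> form w u t1 = 0 ->
  form u v t2 = 0 -> form v w t2 = 1 -> form w u t2 = 0 ->
  form u v t3 = 0 -> form v w t3 = 0 -> form w u t3 = 1 ->
  u ×× v = t1
    + ((form r t1 t2 + form u t2 t3 - form w t1 t3) / 2) *: u
    + ((form w t1 t2 + form v t2 t3 + form r t1 t3) / 2) *: v
    + ((form w t2 t3 + form u t1 t3 - form v t1 t2) / 2) *: w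
    + ((form r t2 t3 - form u t1 t2 - form v t1 t3) / 2) *: r.
Proof.
move=> uvw; rewrite -!metric_cross.
have tab := cross_tableP uvw; have ex := triple_expansion uvw.
move: tab ex; rewrite {}/r; set r := - _; move: r (u ×× v) (v ×× w) (w ×× u).
rewrite /cross_table => r a b c tab ex a1 b1 c1 a2 b2 c2 a3 b3 c3.
have e1 := ex t1; have e2 := ex t2.
rewrite !(metricC _ a) !(metricC _ b) !(metricC _ c) a1 b1 c1 in e1.
rewrite !(scale0r, addr0, scale1r) in e1.
rewrite !(metricC _ a) !(metricC _ b) !(metricC _ c) a2 b2 c2 in e2.
rewrite !(scale0r, addr0, scale1r) in e2.
have d1 x t : dot (x ×× t1) t = dot t1 u * dot (x ×× u) t
    + dot t1 v * dot (x ×× v) t + dot t1 w * dot (x ×× w) t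
    + dot t1 r * dot (x ×× r) t + dot (x ×× a) t.
  by rewrite {1}e1 !crossDr !crossZr !metricDl !metricZl.
have d2 x t : dot (x ×× t2) t = dot t2 u * dot (x ×× u) t
    + dot t2 v * dot (x ×× v) t + dot t2 w * dot (x ×× w) t
    + dot t2 r * dot (x ×× r) t + dot (x ×× b) t.
  by rewrite {1}e2 !crossDr !crossZr !metricDl !metricZl.
pose f x t s := dot (x ×× t) s.
(* Each of the four combinations is chosen so that the unknown coordinates of [t2] and [t3] along
   [u], [v], [w], [r] cancel, leaving twice one coordinate of [t1]. *)
have E1 : f w t1 t3 - f u t2 t3 - f r t1 t2 = 2 * dot t1 u.
  rewrite /f !d1 d2 !tab !(metricNl, metric0l) a2 a3 b2 b3 c2 c3.
  by rewrite !(metricC _ t2) !(metricC _ t3); ring.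
have E2 : f w t1 t2 + f v t2 t3 + f r t1 t3 = - (2 * dot t1 v).
  rewrite /f !d1 d2 !tab !(metricNl, metric0l) a2 a3 b2 b3 c2 c3.
  by rewrite !(metricC _ t2) !(metricC _ t3); ring.
have E3 : f v t1 t2 - f w t2 t3 - f u t1 t3 = 2 * dot t1 w.
  rewrite /f !d1 d2 !tab !(metricNl, metric0l) a2 a3 b2 b3 c2 c3.
  by rewrite !(metricC _ t2) !(metricC _ t3); ring.
have E4 : f u t1 t2 + f v t1 t3 - f r t2 t3 = 2 * dot t1 r.
  rewrite /f !d1 d2 !tab !(metricNl, metric0l) a2 a3 b2 b3 c2 c3.
  by rewrite !(metricC _ t2) !(metricC _ t3); ring.
rewrite -!/(f _ _ _).
have two : (2 : R) != 0 by rewrite pnatr_eq0.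
have -> : (f r t1 t2 + f u t2 t3 - f w t1 t3) / 2 = - dot t1 u.
  by apply: (mulIf two); rewrite divfK//; move: E1; lra.
have -> : (f w t1 t2 + f v t2 t3 + f r t1 t3) / 2 = - dot t1 v.
  by apply: (mulIf two); rewrite divfK//; move: E2; lra.
have -> : (f w t2 t3 + f u t1 t3 - f v t1 t2) / 2 = - dot t1 w.
  by apply: (mulIf two); rewrite divfK//; move: E3; lra.
have -> : (f r t2 t3 - f u t1 t2 - f v t1 t3) / 2 = - dot t1 r.
  by apply: (mulIf two); rewrite divfK//; move: E4; lra.
move: e1; move: (dot t1 u) (dot t1 v) (dot t1 w) (dot t1 r) => k1 k2 k3 k4 ->.
by rewrite !scaleNr -!addrA -!opprD [a + _]addrC !addrA subrr add0r.
Qed.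

(** * Orthogonal complements of R, R' and R'' *)

Section PerpSpan.
Variables (b : nat -> T) (s : R).
Hypothesis ob : forall i j, (i < 7)%N -> (j < 7)%N ->
  dot (b i) (b j) = (i == j)%:R.
Hypothesis s0 : s != 0.

(** The vectors [b 0] to [b 6] will be u, v, w, R, u * v, v * w, w * u. The order 5, 6, 4 is that of
    v * w, w * u, u * v in the theorem. *)
Let bE z : z = (dot z (b 0) *: b 0 + dot z (b 1) *: b 1 + dot z (b 2) *: b 2)
  + dot z (b 3) *: b 3
  + (dot z (b 5) *: b 5 + dot z (b 6) *: b 6 + dot z (b 4) *: b 4).
Proof.
rewrite [LHS](@orthonormal_expansion (fun i => b i)); last first.
  by move=> i j; rewrite ob.
rewrite !big_ord_recr big_ord0 /= add0r -!addrA; do 4!congr (_ + _).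
by rewrite addrC -addrA.
Qed.

Lemma perp_sub (A : set T) y : (forall x, A x -> dot x y = 0) ->
  lspan A `<=` perp phi [set y].
Proof.
move=> Ay; have perpE x : dot x y = 0 -> perp phi [set y] x by move=> xy _ ->.
apply: lspan_min => [x /Ay|||].
- exact: perpE.
- by apply: perpE; rewrite metric0l.
- move=> x x' /(_ _ erefl) xy /(_ _ erefl) x'y.
  by apply: perpE; rewrite metricDl xy x'y addr0.
- by move=> k x /(_ _ erefl) xy; apply: perpE; rewrite metricZl xy mulr0.
Qed.

(** Only the coefficient of [b 3] must vanish. Each of the two groups of three is filled by its
    zero-sum combinations and its diagonal vector. *)
Lemma perp_span_R : perp phi [set b 3] = lspan (comb0 (b 0) (b 1) (b 2) `|`
  [set s *: (b 0 + b 1 + b 2); s *: (b 4 + b 5 + b 6)] `|`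
  comb0 (b 5) (b 6) (b 4)).
Proof.
apply/seteqP; split=> [z /(_ _ erefl) z3|].
  rewrite (bE z) z3 scale0r addr0; apply: lspanD; apply: (lspan_comb _ _ _ s0).
  - by move=> x hx; left; left.
  - by left; right; left.
  - by move=> x hx; right.
  - by rewrite (addrC (b 5 + b 6)) addrA; left; right; right.
apply: perp_sub => x [[[k1 [k2 [k3 [_ ->]]]]|[->|->]]|[k1 [k2 [k3 [_ ->]]]]];
  by rewrite !(metricDl, metricZl) !ob//= ?mulr0 ?addr0 ?mulr0.
Qed.

(** Orthogonality to the diagonal of a group says that the three coefficients in this group sum to
    0, which is the condition in [comb0]. *)
Lemma perp_span_R' : perp phi [set s *: (b 4 + b 5 + b 6)] =
  lspan (comb0 (b 0) (b 1) (b 2) `|` [set s *: (b 0 + b 1 + b 2); b 3] `|`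
  comb0 (b 5) (b 6) (b 4)).
Proof.
apply/seteqP; split=> [z /(_ _ erefl)|].
  rewrite metricZr !metricDr => /eqP; rewrite mulf_eq0 (negPf s0) /= => /eqP z0.
  rewrite (bE z); apply: lspanD; first apply: lspanD.
  - apply: (lspan_comb _ _ _ s0); first by move=> x hx; left; left.
    by left; right; left.
  - by apply/lspanZ/lspan_gen; left; right; right.
  - by apply: lspan_comb0 => [x hx|]; [right|rewrite -z0; ring].
apply: perp_sub => x [[[k1 [k2 [k3 [_ ->]]]]|[->|->]]|[k1 [k2 [k3 [k0 ->]]]]];
  rewrite ?(metricDl, metricZl) ?(metricDr, metricZr) !ob//=
    ?(mulr0, mulr1, addr0, add0r)//.
by rewrite -!mulrDl k0 mul0r.
Qed.

Lemma perp_span_R'' : perp phi [set s *: (b 0 + b 1 + b 2)] =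
  lspan (comb0 (b 0) (b 1) (b 2) `|` [set b 3; s *: (b 4 + b 5 + b 6)] `|`
  comb0 (b 5) (b 6) (b 4)).
Proof.
apply/seteqP; split=> [z /(_ _ erefl)|].
  rewrite metricZr !metricDr => /eqP; rewrite mulf_eq0 (negPf s0) /= => /eqP z0.
  rewrite (bE z); apply: lspanD; first apply: lspanD.
  - by apply: lspan_comb0 => [x hx|//]; left; left.
  - by apply/lspanZ/lspan_gen; left; right; left.
  - apply: (lspan_comb _ _ _ s0); first by move=> x hx; right.
    by rewrite (addrC (b 5 + b 6)) addrA; left; right; right.
apply: perp_sub => x [[[k1 [k2 [k3 [k0 ->]]]]|[->|->]]|[k1 [k2 [k3 [_ ->]]]]];
  rewrite ?(metricDl, metricZl) ?(metricDr, metricZr) !ob//=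
    ?(mulr0, mulr1, addr0, add0r)//.
by rewrite -!mulrDl k0 mul0r.
Qed.

Lemma lspan_orthonormal :
  lspan [set b 0; b 1; b 2; b 3; b 4; b 5; b 6] = setT.
Proof.
apply/seteqP; split=> // z _; rewrite (bE z).
have G i : (i < 7)%N ->
    lspan [set b 0; b 1; b 2; b 3; b 4; b 5; b 6] (dot z (b i) *: b i).
  move=> i7; apply/lspanZ/lspan_gen; move: i i7.
  by move=> [|[|[|[|[|[|[|i]]]]]]]//= _; tauto.
by do !apply: lspanD; exact: G.
Qed.

End PerpSpan.

(** * The operators J, computed from the multiplication table *)

Section TripleJ.
Variables u v w r a b c : T.
Hypothesis tab : cross_table u v w r a b c.
Variables (s k l m : R).

Lemma J_R_plane :
  r ×× (k *: u + l *: v + m *: w) = - (k *: b) - l *: c - m *: a.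
Proof. by rewrite !(crossDr, crossZr) !tab !scalerN. Qed.

Lemma J_R_R'' : r ×× (s *: (u + v + w)) = - (s *: (a + b + c)).
Proof.
(* Pairing with an arbitrary [t] turns the vector identity into an identity of real numbers; the
   same device serves in the next lemmas. *)
rewrite !(crossDr, crossZr) !tab; apply: metric_ext => t.
by rewrite !(metricDl, metricZl, metricNl); ring.
Qed.

(** By the table the [r] component of the product is [s * (k + l + m)], which the hypothesis
    removes. *)
Lemma J_R'_plane : k + l + m = 0 ->
  (s *: (a + b + c)) ×× (k *: u + l *: v + m *: w) =
  - (s *: ((l - m) *: u + (m - k) *: v + (k - l) *: w)).
Proof.
move=> klm; have -> : m = - (k + l).
  by apply/eqP; rewrite eq_sym eqr_oppLR -addr_eq0 klm.
rewrite !(crossDr, crossZr, crossDl, crossZl) !tab; apply: metric_ext => t.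
by rewrite !(metricDl, metricZl, metricNl); ring.
Qed.

Lemma J_R'_planes : (s *: (a + b + c)) ×× (k *: b + l *: c + m *: a) =
  s *: ((l - m) *: b + (m - k) *: c + (k - l) *: a).
Proof.
rewrite !(crossDr, crossZr, crossDl, crossZl) !tab; apply: metric_ext => t.
by rewrite !(metricDl, metricZl, metricNl, metric0l); ring.
Qed.

(** The products [b ×× u], [c ×× v], [a ×× w] each give [r] and the other six cancel in pairs, so
    the result is [3 * s ^+ 2] times [r]. *)
Lemma J_R'_R'' : s ^+ 2 = 3^-1 ->
  (s *: (a + b + c)) ×× (s *: (u + v + w)) = r.
Proof.
move=> s2; have s3 : s * s * 3 = 1 by rewrite -expr2 s2 mulVf// pnatr_eq0.
rewrite !(crossDr, crossZr, crossDl, crossZl) !tab; apply: metric_ext => t.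
rewrite !(metricDl, metricZl, metricNl) -[RHS]mul1r -s3; ring.
Qed.

Lemma J_R''_plane : (s *: (u + v + w)) ×× (k *: u + l *: v + m *: w) =
  s *: ((l - k) *: a + (m - l) *: b + (k - m) *: c).
Proof.
rewrite !(crossDr, crossZr, crossDl, crossZl) !tab; apply: metric_ext => t.
by rewrite !(metricDl, metricZl, metricNl, metric0l); ring.
Qed.

Lemma J_R''_R : (s *: (u + v + w)) ×× r = s *: (a + b + c).
Proof.
rewrite !(crossDl, crossZl) !tab; apply: metric_ext => t.
by rewrite !(metricDl, metricZl); ring.
Qed.

End TripleJ.

End G2Tangent.

(** * Smoothness of vector fields in a chart *)

Section ChartFields.
Variables (R : realType) (n : nat) (M : smooth_manifold R n).
Variables (c : chart R n M) (Ac : atlas c) (U : set M) (oU : open U).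
Local Notation D := (c @` (chart_dom c `&` U)).

Lemma open_chart_image : open D.
Proof.
rewrite openE => _ [p [cp Up] <-]; rewrite /interior.
have cpi : chart_img c (c p) by exists p.
have H1 : \forall x \near c p, chart_img c x.
  by apply: open_nbhs_nbhs; split=> //; exact: chart_img_open.
have H2 : \forall x \near c p, U (chart_inv c x).
  apply: (chart_inv_cont (c := c)); first exact: mem_set.
  by rewrite chart_mapK ?inE//; exact: open_nbhs_nbhs.
apply: filterS2 H1 H2 => _ [q cq <-]; rewrite chart_mapK ?inE// => Uq.
by exists q.
Qed.

Lemma chart_inv_image x : D x -> chart_around (chart_inv c x) c /\ U (chart_inv c x).
Proof. by move=> [p [cp Up] <-]; rewrite chart_mapK ?inE. Qed.

Lemma tcoordD p (s t : tangent p) : tcoord c (s + t) = tcoord c s + tcoord c t.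
Proof. by []. Qed.

Lemma tcoordZ p k (t : tangent p) : tcoord c (k *: t) = k *: tcoord c t.
Proof. by []. Qed.

(** The coordinates in one chart determine those in all others through the transition
    derivatives. *)
Lemma tcoord_inj p : chart_around p c -> injective (@tcoord R n M c p).
Proof.
move=> pc s t st; apply: val_inj; apply/funext => d.
have /asboolP[s0 sE] := valP s; have /asboolP[t0 tE] := valP t.
have [pd|npd] := pselect (chart_around p d); last by rewrite s0// t0.
by rewrite (sE c d)// (tE c d)//; congr ('d _ _ _).
Qed.

Definition coord_field (i : 'I_n) : vector_field M :=
  fun p => tangent_of c p (delta_mx 0 i).

Lemma coord_fieldE p (t : tangent p) : chart_around p c ->
  t = \sum_i tcoord c t 0 i *: coord_field i p.
Proof.
move=> pc; apply: (tcoord_inj pc).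
have sumE (s : seq 'I_n) :
    tcoord c (\sum_(i <- s) tcoord c t 0 i *: coord_field i p) =
    \sum_(i <- s) tcoord c t 0 i *: delta_mx 0 i.
  elim: s => [|i s IH]; first by rewrite !big_nil.
  by rewrite !big_cons tcoordD tcoordZ IH tangent_of_coord.
by rewrite sumE -row_sum_delta.
Qed.

Definition smooth_fun (f : M -> R) := smooth_on D (fun x => f (chart_inv c x) : R^o).
Definition smooth_vec (xi : vector_field M) :=
  smooth_on D (fun x => tcoord c (xi (chart_inv c x))).

Let oD := open_chart_image.

Lemma smooth_vec_eq (xi eta : vector_field M) :
  (forall p, U p -> chart_around p c -> xi p = eta p) ->
  smooth_vec xi -> smooth_vec eta.
Proof.
move=> E; apply: smooth_eq => // x /chart_inv_image[pc Up].
by rewrite E.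
Qed.

Lemma smooth_fun_eq (f g : M -> R) :
  (forall p, U p -> chart_around p c -> f p = g p) -> smooth_fun f -> smooth_fun g.
Proof.
move=> E; apply: smooth_eq => // x /chart_inv_image[pc Up].
by rewrite E.
Qed.

Lemma smooth_vecD xi eta : smooth_vec xi -> smooth_vec eta ->
  smooth_vec (fun p => xi p + eta p).
Proof. exact: smoothD. Qed.

Lemma smooth_vecZ f xi : smooth_fun f -> smooth_vec xi ->
  smooth_vec (fun p => f p *: xi p).
Proof.
move=> sf sxi; apply: smooth_row => // i.
apply: (smooth_eq oD) (smoothM oD sf (smooth_entry oD 0 i sxi)) => x _.
by rewrite tcoordZ mxE.
Qed.

Lemma smooth_vec_sum (I : Type) (s : seq I) (xi : I -> vector_field M) :
  (forall i, smooth_vec (xi i)) -> smooth_vec (fun p => \sum_(i <- s) xi i p).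
Proof.
move=> sxi; elim: s => [|i s IH].
  apply: (smooth_eq oD (f := fun=> 0)) => [x _|]; first by rewrite big_nil.
  exact: smooth_cst.
by apply: (smooth_eq oD) (smooth_vecD (sxi i) IH) => x _; rewrite big_cons.
Qed.

Lemma smooth_coord_field i : smooth_vec (coord_field i).
Proof.
apply: (smooth_eq oD (f := fun=> delta_mx 0 i)); last exact: smooth_cst.
by move=> x /chart_inv_image[pc _]; rewrite tangent_of_coord.
Qed.

Definition smooth_mxf m k (F : M -> 'M[R]_(m, k)) :=
  smooth_mx D (fun x => F (chart_inv c x)).

Lemma smooth_mxfM m k l (F : M -> 'M[R]_(m, k)) (G : M -> 'M[R]_(k, l)) :
  smooth_mxf F -> smooth_mxf G -> smooth_mxf (fun p => F p *m G p).
Proof. exact: smooth_mulmx. Qed.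

(** A smooth right inverse for a matrix field of full row rank. It serves both to solve an
    overdetermined linear system for R and to produce dual vector fields. *)
Lemma smooth_mxf_pinv m k (F : M -> 'M[R]_(m, k)) :
  (forall p, U p -> chart_around p c ->
    forall z : 'rV[R]_m, z *m F p = 0 -> z = 0) ->
  smooth_mxf F -> smooth_mxf (fun p => (F p)^T *m invmx (F p *m (F p)^T)).
Proof.
move=> Finj sF; have sFT := smooth_trmx oD sF.
apply: (smooth_mulmx oD sFT).
apply: (@smooth_invmx _ _ _ oD _ (fun x => _ *m _)); last exact: smooth_mulmx.
by move=> x /chart_inv_image[pc Up]; apply: gram_unitmx; exact: Finj.
Qed.

Lemma smooth_mxf_row_mx m k l (F : M -> 'M[R]_(m, k)) (G : M -> 'M[R]_(m, l)) :
  smooth_mxf F -> smooth_mxf G -> smooth_mxf (fun p => row_mx (F p) (G p)).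
Proof.
move=> sF sG i j; rewrite -(splitK j); case: (fintype.split j) => a.
  by apply: (smooth_eq oD) (sF i a) => x _; rewrite row_mxEl.
by apply: (smooth_eq oD) (sG i a) => x _; rewrite row_mxEr.
Qed.

Lemma smooth_mxf_mx m k (f : 'I_m -> 'I_k -> M -> R) :
  (forall i j, smooth_fun (f i j)) ->
  smooth_mxf (fun p => \matrix_(i, j) f i j p).
Proof. by move=> sf i j; apply: (smooth_eq oD) (sf i j) => x _; rewrite mxE. Qed.

Lemma smooth_vec_mx (F : M -> 'rV[R]_n) (xi : vector_field M) :
  (forall p, U p -> chart_around p c -> tcoord c (xi p) = F p) ->
  smooth_mxf F -> smooth_vec xi.
Proof.
move=> xiF sF; apply: smooth_row => // i.
by apply: (smooth_eq oD) (sF 0 i) => x /chart_inv_image[pc Up]; rewrite xiF.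
Qed.

End ChartFields.

(** * Smoothness of R and of the cross products *)

Section G2Fields.
Variables (R : realType) (M : smooth_manifold R 7) (phi : G2_structure M).
Variables (c : chart R 7 M) (Ac : atlas c) (U : set M) (oU : open U).
Local Notation svec := (@smooth_vec R 7 M c U).
Local Notation sfun := (@smooth_fun R 7 M c U).
Local Notation E := (@coord_field R 7 M c).
Local Notation form := (@G2_form R M phi _).

Lemma form_sum1 p (I : Type) (s : seq I) (a : I -> R) (g : I -> tangent p) y z :
  form (\sum_(i <- s) a i *: g i) y z = \sum_(i <- s) a i * form (g i) y z.
Proof.
elim: s => [|i s IH]; last by rewrite !big_cons formPl IH.
by rewrite !big_nil -metric_cross cross0l metric0l.
Qed.

Lemma form_sum3 p (I : Type) (s : seq I) (a : I -> R) (g : I -> tangent p) x y :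
  form x y (\sum_(i <- s) a i *: g i) = \sum_(i <- s) a i * form x y (g i).
Proof.
rewrite -form_cycle form_sum1; apply: eq_bigr => i _.
by rewrite form_cycle.
Qed.

Lemma form_sum2 p (I : Type) (s : seq I) (a : I -> R) (g : I -> tangent p) x z :
  form x (\sum_(i <- s) a i *: g i) z = \sum_(i <- s) a i * form x (g i) z.
Proof.
rewrite form_cycle form_sum1; apply: eq_bigr => i _.
by rewrite -form_cycle.
Qed.

Lemma metric_sum p (I : Type) (s : seq I) (a : I -> R) (g : I -> tangent p) y :
  metric phi (\sum_(i <- s) a i *: g i) y = \sum_(i <- s) a i * metric phi (g i) y.
Proof.
elim: s => [|i s IH]; first by rewrite !big_nil metric0l.
by rewrite !big_cons metricPl IH.
Qed.

(** Smoothness of [phi] enters here: expanding the three fields in the coordinate frame reduces the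
    claim to the coefficients of [phi] in the chart. *)
Lemma smooth_form xi eta zeta : svec xi -> svec eta -> svec zeta ->
  sfun (fun p => form (xi p) (eta p) (zeta p)).
Proof.
move=> sx se sz; have oD := @open_chart_image _ _ _ c _ oU.
pose f p := \sum_i tcoord c (xi p) 0 i * \sum_j tcoord c (eta p) 0 j *
  \sum_k tcoord c (zeta p) 0 k * form (E i p) (E j p) (E k p).
apply: (smooth_fun_eq Ac oU (f := f)) => [p Up pc|].
  rewrite [X in form X](coord_fieldE (xi p) pc) form_sum1.
  apply: eq_bigr => i _; congr (_ * _).
  rewrite [X in form _ X](coord_fieldE (eta p) pc) form_sum2.
  apply: eq_bigr => j _; congr (_ * _).
  by rewrite [X in form _ _ X](coord_fieldE (zeta p) pc) form_sum3.
apply: smooth_sum => // i; apply: smoothM => //; first exact: smooth_entry.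
apply: smooth_sum => // j; apply: smoothM => //; first exact: smooth_entry.
apply: smooth_sum => // k; apply: smoothM => //; first exact: smooth_entry.
move=> d; apply: (@Ck_subset _ _ _ _ (chart_img c)); last first.
  exact: (G2_smooth phi Ac (delta_mx 0 i) (delta_mx 0 j) (delta_mx 0 k) d).
by move=> _ [p [cp _] <-]; exists p.
Qed.

Section TripleFields.
Variables u v w : vector_field M.
Hypothesis uvw : forall p, U p -> coassociative_triple phi (u p) (v p) (w p).
Hypotheses (su : svec u) (sv : svec v) (sw : svec w).

Let sE i : svec (E i). Proof. exact: smooth_coord_field. Qed.

Let form_coord p (x y t : tangent p) : chart_around p c ->
  \sum_i tcoord c t 0 i * form x y (E i p) = form x y t.
Proof. by move=> pc; rewrite -form_sum3 -coord_fieldE. Qed.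

Lemma cross_coord_eq0 p (x t : tangent p) : chart_around p c ->
  (forall j, form x t (E j p) = 0) -> cross phi x t = 0.
Proof.
move=> pc xt; apply: (metric_ext (phi := phi)) => z.
by rewrite metric_cross metric0l -form_coord// big1// => j _; rewrite xt mulr0.
Qed.

(* [R] is the only solution of the linear equations
   [u \times R = v \times w] and [v \times R = w \times u], whose coefficients do
   not involve the metric. *)
Lemma smooth_triple_R :
  svec (fun p => - cross phi (u p) (cross phi (v p) (w p))).
Proof.
pose N1 (x : vector_field M) p : 'M[R]_7 :=
  \matrix_(i, j) form (x p) (E i p) (E j p).
pose B1 (x y : vector_field M) p : 'rV[R]_7 := \row_j form (x p) (y p) (E j p).
(* Multiplication by [N] sends the coordinates of [t] to those of the 1-forms [form u t] and
   [form v t]: seven unknowns and fourteen equations, with right-hand side [B]. *)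
pose N p := row_mx (N1 u p) (N1 v p); pose B p := row_mx (B1 v w p) (B1 w u p).
have mulN1 p (t : tangent p) (x : vector_field M) : chart_around p c ->
    tcoord c t *m N1 x p = \row_j form (x p) t (E j p).
  move=> pc; apply/rowP => j; rewrite !mxE -form_cycle -form_coord//.
  by apply: eq_bigr => i _; rewrite mxE (form_cycle phi (E j p)).
have Ninj p : U p -> chart_around p c -> forall z : 'rV[R]_7, z *m N p = 0 -> z = 0.
  move=> Up pc z; pose t := tangent_of c p z.
  have [[uu vv _] [uv _ _ _]] := uvw Up.
  rewrite -(tangent_of_coord z pc) -/t mul_mx_row -[0]row_mx0 !mulN1// => /eq_row_mx.
  case=> /rowP ut /rowP vt.
  (* Applying u again to u * t = 0 gives t = <u,t> u by [cross_sqr], and likewise t = <v,t> v. As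
     [u] and [v] are orthogonal, [t = 0]. *)
  have /(congr1 (cross phi (u p))) : cross phi (u p) t = 0.
    by apply: cross_coord_eq0 => // j; have := ut j; rewrite !mxE.
  have /(congr1 (cross phi (v p))) : cross phi (v p) t = 0.
    by apply: cross_coord_eq0 => // j; have := vt j; rewrite !mxE.
  rewrite !cross_sqr uu vv !scale1r.
  have c0 (y : tangent p) : cross phi y 0 = 0 by rewrite crossC cross0l oppr0.
  rewrite !c0 => /subr0_eq tv /subr0_eq tu.
  have : t = 0.
    rewrite -tv; by rewrite -tu metricZr (metricC _ (v p)) uv mulr0 scale0r.
  by move=> ->.
pose P p := (N p)^T *m invmx (N p *m (N p)^T).
apply: (@smooth_vec_mx _ _ _ _ Ac _ oU (fun p => B p *m P p)) => [p Up pc|].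
  set r := - _.
  have tab := cross_tableP (uvw Up).
  have -> : B p = tcoord c r *m N p.
    rewrite mul_mx_row !mulN1// /B /B1; congr (row_mx _ _); apply/rowP => j.
      by rewrite !mxE -!(metric_cross phi) tab.
    by rewrite !mxE -!(metric_cross phi) tab.
  rewrite /P -mulmxA (mulmxA (N p)) mulmxV ?mulmx1//.
  exact/gram_unitmx/Ninj.
have sN1 x : svec x -> smooth_mxf c U (N1 x).
  by move=> sx; apply: smooth_mxf_mx => // i j; exact: smooth_form.
have sB1 x y : svec x -> svec y -> smooth_mxf c U (B1 x y).
  by move=> sx sy; apply: smooth_mxf_mx => // i j; exact: smooth_form.
apply: smooth_mxfM => //; first by apply: smooth_mxf_row_mx => //; exact: sB1.
by apply: smooth_mxf_pinv => //; apply: smooth_mxf_row_mx => //; exact: sN1.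
Qed.

Lemma smooth_triple_cross : svec (fun p => cross phi (u p) (v p)).
Proof.
pose a k : vector_field M := nth u [:: u; v; w] k.
pose b k : vector_field M := nth u [:: v; w; u] k.
pose N p : 'M[R]_(3, 7) := \matrix_(k, j) form (a k p) (b k p) (E j p).
pose P p := (N p)^T *m invmx (N p *m (N p)^T).
(* The columns of the right inverse [P] are coordinates of fields dual to the three 1-forms in the
   rows of [N]. *)
pose t k : vector_field M := fun p => \sum_i P p i k *: E i p.
have ab p (k l : 'I_3) : U p -> metric phi (cross phi (a k p) (b k p))
    (cross phi (a l p) (b l p)) = (k == l)%:R.
  (* The three cross products occupy positions 4, 5 and 6 in the frame of [triple_orthonormal]. *)
  move=> Up; have /(_ (4 + k)%N (4 + l)%N) := triple_orthonormal (uvw Up).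
  rewrite !(ltn_add2l 4 _ 3) !ltn_ord eqn_add2l => /(_ isT isT) <-.
  by rewrite /a /b; congr (metric phi _ _); [case: k|case: l] => -[|[|[|]]].
have Ninj p : U p -> chart_around p c -> forall z : 'rV[R]_3, z *m N p = 0 -> z = 0.
  (* The entries of [z *m N p] are the inner products of [y] with the coordinate frame. So [y = 0],
     and its coefficients in the orthonormal cross products vanish. *)
  move=> Up pc z zN; pose y := \sum_k z 0 k *: cross phi (a k p) (b k p).
  have y0 : y = 0.
    apply: (metric_ext (phi := phi)) => s.
    rewrite metric0l metric_sum.
    transitivity ((z *m N p *m (tcoord c s)^T) 0 0); last first.
      by rewrite zN mul0mx mxE.
    rewrite -mulmxA mxE; apply: eq_bigr => k _; congr (_ * _).
    rewrite metric_cross -form_coord// mxE; apply: eq_bigr => i _.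
    by rewrite !mxE mulrC.
  apply/rowP => l; rewrite mxE -(metric0l phi (cross phi (a l p) (b l p))) -y0.
  rewrite metric_sum (bigD1 l)//= ab// eqxx mulr1 big1 ?addr0// => k kl.
  by rewrite ab// (negPf kl) mulr0.
have dual p (k l : 'I_3) : U p -> chart_around p c ->
    form (a k p) (b k p) (t l p) = (k == l)%:R.
  move=> Up pc; transitivity ((N p *m P p) k l).
    by rewrite form_sum3 [RHS]mxE; apply: eq_bigr => i _; rewrite [N p k i]mxE mulrC.
  rewrite /P mulmxA mulmxV ?mxE//; exact/gram_unitmx/Ninj.
have sa (k : 'I_3) : svec (a k) by case: k => -[|[|[|]]].
have sb (k : 'I_3) : svec (b k) by case: k => -[|[|[|]]].
have sP : smooth_mxf c U P.
  apply: smooth_mxf_pinv => //; apply: smooth_mxf_mx => // k j.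
  exact: smooth_form.
have st k : svec (t k).
  by apply: smooth_vec_sum => // i; apply: smooth_vecZ => //; exact: sP.
have sr := smooth_triple_R; set r : vector_field M := (X in svec X) in sr.
have oD := @open_chart_image _ _ _ c _ oU.
have half f : sfun f -> sfun (fun p => f p / 2).
  by move=> fs; apply: smoothM => //; exact: smooth_cst.
pose f (x : vector_field M) k l p := form (x p) (t k p) (t l p).
have sfx x k l : svec x -> sfun (f x k l) by move=> sx; exact: smooth_form.
apply: (@smooth_vec_eq _ _ _ _ Ac _ oU (fun p => t 0 p
    + ((f r 0 1 p + f u 1 2 p - f w 0 2 p) / 2) *: u p
    + ((f w 0 1 p + f v 1 2 p + f r 0 2 p) / 2) *: v p
    + ((f w 1 2 p + f u 0 2 p - f v 0 1 p) / 2) *: w p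
    + ((f r 1 2 p - f u 0 1 p - f v 0 2 p) / 2) *: r p)) => [p Up pc|].
  symmetry; apply: cross_from_dual; first exact: uvw.
  - exact: (dual p 0 0 Up pc).
  - exact: (dual p 1 0 Up pc).
  - exact: (dual p 2 0 Up pc).
  - exact: (dual p 0 1 Up pc).
  - exact: (dual p 1 1 Up pc).
  - exact: (dual p 2 1 Up pc).
  - exact: (dual p 0 2 Up pc).
  - exact: (dual p 1 2 Up pc).
  - exact: (dual p 2 2 Up pc).
have sD f1 f2 : sfun f1 -> sfun f2 -> sfun (fun p => f1 p + f2 p).
  by move=> s1 s2; exact: smoothD.
have sB f1 f2 : sfun f1 -> sfun f2 -> sfun (fun p => f1 p - f2 p).
  by move=> s1 s2; exact: smoothB.
apply: smooth_vecD => //; last apply: smooth_vecZ => //; last first.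
  exact: half (sB _ _ (sB _ _ (sfx _ 1 2 sr) (sfx _ 0 1 su)) (sfx _ 0 2 sv)).
apply: smooth_vecD => //; last apply: smooth_vecZ => //; last first.
  exact: half (sB _ _ (sD _ _ (sfx _ 1 2 sw) (sfx _ 0 2 su)) (sfx _ 0 1 sv)).
apply: smooth_vecD => //; last apply: smooth_vecZ => //; last first.
  exact: half (sD _ _ (sD _ _ (sfx _ 0 1 sw) (sfx _ 1 2 sv)) (sfx _ 0 2 sr)).
apply: smooth_vecD => //; last apply: smooth_vecZ => //.
exact: half (sB _ _ (sD _ _ (sfx _ 0 1 sr) (sfx _ 1 2 su)) (sfx _ 0 2 sw)).
Qed.

End TripleFields.
End G2Fields.

(** * Tangent spaces and almost complex structures of the leaves *)

Theorem theorem5 (K : realType) (M : smooth_manifold K 7) (phi : G2_structure M)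
    (hphi : is_G2_manifold phi)
    (u v : vector_field M) (huv : orthonormal_frame phi setT [:: u; v])
    (U : set M) (hUo : open U)
    (hU : (exists S : CW_structure K M, tubular_neighborhood K U (skeleton S 3))
          \/ U = setT)
    (w : vector_field M) (hw : smooth_field U w)
    (hw1 : forall p, U p -> metric phi (w p) (w p) = 1)
    (hwV : forall p, U p ->
       perp phi (lspan [set u p; v p; cross phi (u p) (v p)]) (w p)) :
  let uv : vector_field M := fun p => cross phi (u p) (v p) in
  let vw : vector_field M := fun p => cross phi (v p) (w p) in
  let wu : vector_field M := fun p => cross phi (w p) (u p) in
  let s3 : K := (Num.sqrt 3)^-1 in
  let R : vector_field M := fun p => chi phi (u p) (v p) (w p) in
  let R' : vector_field M := fun p => s3 *: (uv p + vw p + wu p) in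
  let R'' : vector_field M := fun p => s3 *: (u p + v p + w p) in
  [/\ (* the frame (u, v, w) and the two expressions for R *)
      orthonormal_frame phi U [:: u; v; w]
      /\ (forall p, U p ->
            G2_form phi (u p) (v p) (w p) = 0
            /\ R p = - cross phi (u p) (vw p)),
      (* (a) *)
      plane_integrable phi U R ->
      forall (X : smooth_manifold K 6) (iota : X -> M), is_leaf phi U R iota ->
      forall x : X, let p := iota x in
      [/\ range (tangent_map iota x) =
            lspan (comb0 (u p) (v p) (w p) `|` [set R'' p; R' p]
                  `|` comb0 (vw p) (wu p) (uv p)),
          forall a b c : K, a + b + c = 0 ->
            Jxi phi R (a *: u p + b *: v p + c *: w p) =
            - (a *: vw p) - b *: wu p - c *: uv p &
          Jxi phi R (R'' p) = - R' p],
      (* (b) *)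
      plane_integrable phi U R' ->
      forall (X : smooth_manifold K 6) (iota : X -> M), is_leaf phi U R' iota ->
      forall x : X, let p := iota x in
      [/\ range (tangent_map iota x) =
            lspan (comb0 (u p) (v p) (w p) `|` [set R'' p; R p]
                  `|` comb0 (vw p) (wu p) (uv p)),
          forall a b c : K, a + b + c = 0 ->
            Jxi phi R' (a *: u p + b *: v p + c *: w p) =
            - (s3 *: ((b - c) *: u p + (c - a) *: v p + (a - b) *: w p)),
          forall a b c : K, a + b + c = 0 ->
            Jxi phi R' (a *: vw p + b *: wu p + c *: uv p) =
            s3 *: ((b - c) *: vw p + (c - a) *: wu p + (a - b) *: uv p) &
          Jxi phi R' (R'' p) = R p],
      (* (c) *)
      plane_integrable phi U R'' ->
      forall (X : smooth_manifold K 6) (iota : X -> M), is_leaf phi U R'' iota ->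
      forall x : X, let p := iota x in
      [/\ range (tangent_map iota x) =
            lspan (comb0 (u p) (v p) (w p) `|` [set R p; R' p]
                  `|` comb0 (vw p) (wu p) (uv p)),
          forall a b c : K, a + b + c = 0 ->
            Jxi phi R'' (a *: u p + b *: v p + c *: w p) =
            s3 *: ((b - a) *: uv p + (c - b) *: vw p + (a - c) *: wu p) &
          Jxi phi R'' (R p) = R' p] &
      (* (d) *)
      orthonormal_frame phi U [:: u; v; w; R; uv; vw; wu]
      /\ forall p, U p ->
           lspan [set u p; v p; w p; R p; uv p; vw p; wu p] = setT].
Proof.
move=> uv vw wu s3 R R' R''.
have [suv ouv] := huv; have {ouv}ouv p := ouv p Logic.I.
(* Orthogonality of [w] to u * v is the condition phi(u,v,w) = 0; the other relations come from the
   2-frame and from [w] being orthogonal to [u] and [v]. *)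
have triple p : U p -> coassociative_triple phi (u p) (v p) (w p).
  move=> Up; have wV y : lspan [set u p; v p; cross phi (u p) (v p)] y ->
    metric phi (w p) y = 0 by move=> hy; have := hwV p Up y hy.
  split; split.
  - exact: (ouv p 0 0).
  - exact: (ouv p 1 1).
  - exact: hw1.
  - exact: (ouv p 0 1).
  - by rewrite metricC; apply/wV/lspan_gen; left; right.
  - by apply/wV/lspan_gen; left; left.
  - by rewrite -metric_cross metricC; apply/wV/lspan_gen; right.
have RE p : U p -> R p = - cross phi (u p) (vw p).
  move=> /triple[_ [uv0 _ wu0 _]].
  by rewrite /R chiE uv0 metricC wu0 !scale0r subr0 addr0.
have s3n0 : s3 != 0 by rewrite invr_eq0 sqrtr_eq0 -ltNge ltr0n.
have s3sqr : s3 ^+ 2 = 3^-1 by rewrite exprVn sqr_sqrtr// ler0n.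
have restrict (xi : vector_field M) : smooth_field setT xi -> smooth_field U xi.
  move=> sxi c Ac k; apply: Ck_subset (sxi c Ac k).
  by move=> _ [p [cp _] <-]; exists p.
have su : smooth_field U u by exact: restrict (suv 0 isT).
have sv : smooth_field U v by exact: restrict (suv 1 isT).
(* The cyclic shifts give the smoothness of v * w and w * u from the lemma for the first cross
   product. *)
have tri1 p : U p -> coassociative_triple phi (v p) (w p) (u p).
  by move=> /triple/triple_cycle.
have tri2 p : U p -> coassociative_triple phi (w p) (u p) (v p).
  by move=> /tri1/triple_cycle.
have sR : smooth_field U R.
  move=> c Ac.
  have := smooth_triple_R Ac hUo triple (su c Ac) (sv c Ac) (hw c Ac).
  by apply: smooth_vec_eq => // p Up _; rewrite RE.
have suv' : smooth_field U uv.
  move=> c Ac.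
  exact: (smooth_triple_cross Ac hUo triple (su c Ac) (sv c Ac) (hw c Ac)).
have svw : smooth_field U vw.
  move=> c Ac.
  exact: (smooth_triple_cross Ac hUo tri1 (sv c Ac) (hw c Ac) (su c Ac)).
have swu : smooth_field U wu.
  move=> c Ac.
  exact: (smooth_triple_cross Ac hUo tri2 (hw c Ac) (su c Ac) (sv c Ac)).
pose b p (i : nat) : tangent p := nth 0 [:: u p; v p; w p; R p; uv p; vw p; wu p] i.
have ob p : U p -> forall i j, (i < 7)%N -> (j < 7)%N ->
    metric phi (b p i) (b p j) = (i == j)%:R.
  by move=> Up; rewrite /b RE//; exact: triple_orthonormal (triple p Up).
have tab p : U p -> cross_table phi (u p) (v p) (w p) (R p) (uv p) (vw p) (wu p).
  by move=> Up; rewrite RE//; exact: cross_tableP (triple p Up).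
(* The tangent space of a leaf is the orthogonal complement of the field by definition, so each span
   reduces to linear algebra at the point [iota x] of [U]. *)
have leaf (xi : vector_field M) (X : smooth_manifold K 6) (iota : X -> M) (x : X) :
    is_leaf phi U xi iota ->
    U (iota x) /\ range (tangent_map iota x) = perp phi [set xi (iota x)].
  move=> [_ [_ _ iU _ _ tan] _]; split; last exact: tan.
  by apply: iU; exists x.
split.
- split; last first.
    by move=> p Up; split; [case: (triple p Up) => _ []|exact: RE].
  split=> [[|[|[|i]]]//=|p Up i j i3 j3].
  have nthE k : (k < 3)%N -> nth (fun=> 0) [:: u; v; w] k p = b p k.
    by case: k => [|[|[|k]]].
  by rewrite !nthE//; apply: (ob p Up); exact: ltn_trans (_ : _ < 3)%N _.
- move=> _ X iota lf x p; have [Up ->] := leaf _ _ _ x lf; split.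
  + exact: (perp_span_R (ob p Up) s3n0).
  + by move=> a b' c _; exact: (J_R_plane (tab p Up)).
  + exact: (J_R_R'' (tab p Up)).
- move=> _ X iota lf x p; have [Up ->] := leaf _ _ _ x lf; split.
  + exact: (perp_span_R' (ob p Up) s3n0).
  + by move=> a b' c abc; exact: (J_R'_plane (tab p Up)).
  + by move=> a b' c _; exact: (J_R'_planes (tab p Up)).
  + exact: (J_R'_R'' (tab p Up)).
- move=> _ X iota lf x p; have [Up ->] := leaf _ _ _ x lf; split.
  + exact: (perp_span_R'' (ob p Up) s3n0).
  + by move=> a b' c _; exact: (J_R''_plane (tab p Up)).
  + exact: (J_R''_R (tab p Up)).
- split; last by move=> p Up; exact: (lspan_orthonormal (ob p Up)).
  split=> [[|[|[|[|[|[|[|i]]]]]]]//=|p Up i j i7 j7].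
  have nthE k : (k < 7)%N -> nth (fun=> 0) [:: u; v; w; R; uv; vw; wu] k p = b p k.
    by case: k => [|[|[|[|[|[|[|k]]]]]]].
  by rewrite !nthE//; exact: ob.
Qed.
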